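(* Define integers $C_{1^{3}2^{-2}3^{3}}(n)$ by \[ \frac{(q;q)_\infty^{3}\,(q^3;q^3)_\infty^{3}}{(q^2;q^2)_\infty^{2}}=\sum_{n\geq 0} C_{1^{3}2^{-2}3^{3}}(n)\,q^n . \] Then the sequence $\{\operatorname{sgn}(C_{1^{3}2^{-2}3^{3}}(n))\}_{n\geq 1}$ is periodic with period $2$; in particular, for every $n\geq 1$, \[ (-1)^n C_{1^{3}2^{-2}3^{3}}(n)>0 . \]
   Context: $(a;q)_\infty:=\prod_{j\geq 0}(1-aq^j)$ denotes the $q$-Pochhammer symbol; the identity is one of formal power series in $q$. *)

(* Defs.v *)
(* Formal power series in q with integer coefficients are
   handled through polynomial truncations: the coefficient of q^n of an
   infinite product prod_{j>=1} f_j(q) with f_j = 1 + O(q^j) equals the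
   coefficient of q^n of the finite product over 1 <= j <= n. *)
From HB Require Import structures.
From mathcomp Require Import all_boot all_order all_algebra.
Set Implicit Arguments. Unset Strict Implicit. Unset Printing Implicit Defensive.
Import Order.TTheory GRing.Theory Num.Theory.
Local Open Scope ring_scope.

(* (q^m;q^m)_infty = prod_{j>=0} (1 - q^m q^(m j)) = prod_{j>=1} (1 - q^(m j)),
   truncated to the factors 1 <= j <= N (exact modulo q^(N+1) for m >= 1). *)
Definition qpoch_trunc (m N : nat) : {poly int} :=
  \prod_(1 <= j < N.+1) (1 - 'X^(m * j)).

(* 1/(q^m;q^m)_infty = prod_{j>=1} sum_{k>=0} q^(m j k), truncated: only factors
   1 <= j <= N and geometric terms k <= N (exact modulo q^(N+1) for m >= 1). *)
Definition qpoch_inv_trunc (m N : nat) : {poly int} :=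
  \prod_(1 <= j < N.+1) \sum_(0 <= k < N.+1) 'X^(m * j * k).

Definition C_eta (n : nat) : int :=
  ((qpoch_trunc 1 n) ^+ 3 * (qpoch_trunc 3 n) ^+ 3
     * (qpoch_inv_trunc 2 n) ^+ 2)`_n.

(* Main.v *)
Require Import Defs.
From HB Require Import structures.
From mathcomp Require Import all_boot all_order all_algebra.
From mathcomp Require Import ring lra zify.
Import Order.TTheory GRing.Theory Num.Theory.
Local Open Scope ring_scope.

Set Implicit Arguments.
Unset Strict Implicit.
Unset Printing Implicit Defensive.

(** Write f_m = (q^m; q^m)_oo.  The quotient factors as
    (f_1 f_3 f_6 / f_2) (f_1^2 f_3^2 / (f_2 f_6)), and both factors come
    from Kronecker's identity
      sum_k x^k / (1 - z p^k) = (p; p)^2 theta (x z) / (theta x theta z).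
    At x = - t^2 q^2, z = - t^2 q, p = q^6 it expresses f_1 f_3 f_6 / f_2
    (at t = 1) as a Lambert series, and the logarithmic derivative in t of the
    product side at t = 1 is again a Lambert series, which Kronecker's identity
    at x = - q, z = - 1, p = q^3 evaluates to f_1^2 f_3^2 / (f_2 f_6).  So the
    t-derivative of the double series is the eta quotient, which gives
      3 (-1)^n C(n) = sum_{a b = 3 n + 1} chi12 a (a + 2 b),
    where chi12 is the quadratic character modulo 12; this is positive since
    sum_{a b = N} chi12 a b is, and bounds |sum_{a b = N} chi12 a a|. *)

(** No limits and no second variable are used. Every identity lives in a field with a distinguished
    q, so that fractions simplify freely, and holds modulo q^N relative to a subring [O] of
    fractions expandable in q. Kronecker's identity is the limit of the partial fraction expansion
    of (x z; p)_n / (z; p)_(n+1): replacing z by z / p^A slides the index k to the range - A .. B.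
    The negative half would bring negative powers of p; with w = p / (x z) its term k = - m - 1
    becomes - w (z w)^m / (1 - x w p^m).

    The specialisation makes the derivative at t = 1 simple. The numerator (t^4 q^3; q^6) (t^-4 q^3;
    q^6) is symmetric under t -> 1 / t and contributes nothing; the four denominator products give a
    Lambert series without its constant term, which the factor t put in front of the identity
    supplies. The same factor makes the exponents of t equal to 2 (k + m) + 1 and - (2 (k + m) + 3),
    and three times their absolute values are the weights a + 2 b. *)

Definition qpoch (R : pzRingType) (p a : R) (n : nat) : R :=
  \prod_(i < n) (1 - a * p ^+ i).

Lemma qpochS (R : pzRingType) (p a : R) n :
  qpoch p a n.+1 = qpoch p a n * (1 - a * p ^+ n).
Proof. by rewrite /qpoch big_ord_recr. Qed.

Lemma qpoch_head (R : comPzRingType) (p a : R) n :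
  qpoch p a n.+1 = (1 - a) * qpoch p (a * p) n.
Proof.
rewrite /qpoch big_ord_recl expr0 mulr1; congr (_ * _).
by apply: eq_bigr => i _; rewrite exprS mulrA.
Qed.

Lemma qpoch_neq0 (F : fieldType) (p a : F) n :
  (forall i, 1 - a * p ^+ i != 0) -> qpoch p a n != 0.
Proof. by move=> h; rewrite /qpoch prodf_seq_neq0; apply/allP=> i _; rewrite h. Qed.

(** * Finite partial fractions, one-sided and bilateral *)

Section PartialFractions.
Variables (F : fieldType) (p x y : F).
Hypotheses (pxy : p = x * y) (p_unit : forall i, 1 - p * p ^+ i != 0).
Local Notation poch := (qpoch p).

(** The residue coefficients of (x z; p)_n / (z; p)_(n+1) at z = p^(-k); the k factors of the
    numerator with negative powers of p are reflected into (y; p)_k with y = p / x. *)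
Let u n k := x ^+ k * poch x (n - k) * poch y k / (poch p k * poch p (n - k)).

(* Induction on n through (1 - p^(n+1)) S_(n+1)(z)
   = (1 - x z p^n) S_n(z) - p^(n+1) (1 - x z) S_n(z p). *)
Lemma pf_unilateral n z : (forall i, 1 - z * p ^+ i != 0) ->
  \sum_(k < n.+1) x ^+ k * poch x (n - k) * poch y k
      / (poch p k * poch p (n - k)) / (1 - z * p ^+ k)
  = poch (x * z) n / poch z n.+1.
Proof.
have pp0 k : poch p k != 0 by exact: qpoch_neq0.
elim: n z => [|n IHn] z hz.
  by rewrite big_ord1 /qpoch !big_ord0 big_ord1 !mul1r !invr1 !mul1r.
have hzp i : 1 - z * p * p ^+ i != 0 by rewrite -mulrA -exprS.
apply: (mulfI (p_unit n)).
rewrite (eq_bigr (fun k : 'I_n.+2 => u n.+1 k / (1 - z * p ^+ k))) // mulr_sumr.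
(* This splitting of 1 - p^(n+1) kills the term k = n + 1 of the first part and k = 0 of the second;
   once the second is reindexed, both run over k <= n. *)
transitivity (\sum_(k < n.+2) ((1 - p ^+ (n.+1 - k)) * u n.+1 k / (1 - z * p ^+ k)
   + p ^+ (n.+1 - k) * (1 - p ^+ k) * u n.+1 k / (1 - z * p ^+ k))).
  apply: eq_bigr => k _; rewrite -mulrDl -exprS mulrA -mulrDl.
  have kn : (k <= n.+1)%N by rewrite -ltnS.
  by congr (_ * _ / _); rewrite -{1}(subnK kn) exprD; ring.
rewrite big_split /= big_ord_recr /= subnn expr0 subrr !mul0r addr0.
rewrite [X in _ + X]big_ord_recl /= expr0 subrr mulr0 !mul0r add0r -big_split /=.
transitivity (\sum_(k < n.+1) ((1 - x * z * p ^+ n) * (u n k / (1 - z * p ^+ k))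
   - p ^+ n.+1 * (1 - x * z) * (u n k / (1 - z * p * p ^+ k)))).
  apply: eq_bigr => -[k /=]; rewrite ltnS => kn _.
  have [m nE] : exists m, n = (k + m)%N by exists (n - k)%N; rewrite subnKC.
  rewrite /bump /= add1n subSS subSn // nE addKn.
  rewrite /u -addnS addKn addnS subSS addKn !qpochS !exprS.
  rewrite exprD.
  move: (pp0 k) (pp0 m) (p_unit k) (p_unit m) (hz k) (hzp k).
  rewrite -[z * p * _]mulrA.
  move: (poch p k) (poch p m) (poch x m) (poch y k) (p ^+ k) (p ^+ m) (x ^+ k).
  rewrite pxy => a b c d e f g h1 h2 h3 h4 h5 h6.
  by field; rewrite h1 h2 h3 h4 h5 h6.
have xzE : (1 - x * z * p ^+ n) * poch (x * z) n = (1 - x * z) * poch (x * (z * p)) n.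
  by rewrite mulrC -qpochS qpoch_head -mulrA.
rewrite sumrB -!mulr_sumr !IHn // [(1 - _) * (_ / _)]mulrA xzE.
rewrite [poch (x * z) n.+1]qpochS [poch (x * z) n * _]mulrC xzE.
rewrite [poch z n.+2]qpoch_head [poch z n.+1]qpoch_head [poch (z * p) n.+1]qpochS.
move: (hz 0) (hzp n) (qpoch_neq0 n hzp); rewrite expr0 mulr1 exprS.
move: (poch (z * p) n) (p ^+ n) (poch (x * (z * p)) n) => a b c h1 h2 h3.
by field; rewrite h1 h2 h3.
Qed.
End PartialFractions.

Section BilateralPartialFractions.
Variables (F : fieldType) (p x z w : F).
Hypotheses (pE : p = x * z * w) (p0 : p != 0).
Hypotheses (p_unit : forall i, 1 - p * p ^+ i != 0).
Hypotheses (z_unit : forall i, 1 - z * p ^+ i != 0).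
Hypotheses (xw_unit : forall i, 1 - x * w * p ^+ i != 0).
Local Notation poch := (qpoch p).

(** Each of the first A factors is 1 - a / p^(i+1) = - (a / p^(i+1)) (1 - p^(i+1) / a). The product
    of the signed powers of p does not depend on a, so it cancels between numerator and denominator
    in [pf_bilateral]. *)
Lemma qpoch_shift a A m : a != 0 ->
  poch (a / p ^+ A) (A + m)
  = poch a m * (a ^+ A * \prod_(i < A) - (p ^+ i.+1)^-1 * poch (p / a) A).
Proof.
move=> a0; elim: A => [|A IHA].
  by rewrite add0n /qpoch !big_ord0 expr0 invr1 !mulr1.
have pA0 : p ^+ A != 0 by rewrite expf_neq0.
rewrite addSn qpoch_head (_ : a / p ^+ A.+1 * p = a / p ^+ A); last first.
  by rewrite exprS; field; rewrite ?p0 ?pA0.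
rewrite IHA qpochS big_ord_recr /= !exprS.
move: (\prod_(i < A) _) (poch _ _) (poch _ _) => b c d.
by field; rewrite pA0 p0 a0.
Qed.

(* This is [pf_unilateral] at z / p^A, with n = A + B and the index recentred
   at A.  The second sum is the part k = - m - 1, rewritten without negative
   powers by means of p = x z w. *)
Lemma pf_bilateral A B :
  \sum_(k < B.+1) x ^+ k * poch x (B - k) * poch (z * w) (A + k)
      / (poch p (A + k) * poch p (B - k)) / (1 - z * p ^+ k)
  - w * \sum_(m < A) (z * w) ^+ m * poch x (B + m.+1) * poch (z * w) (A - m.+1)
      / (poch p (A - m.+1) * poch p (B + m.+1)) / (1 - x * w * p ^+ m)
  = poch (x * z) B * poch w A / (poch z B.+1 * poch (x * w) A).
Proof.
have := p0; rewrite {1}pE !mulf_eq0 !negb_or => /andP[/andP[x0 z0] w0].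
have pn0 n : p ^+ n != 0 by rewrite expf_neq0.
have zA i : 1 - z / p ^+ A * p ^+ i != 0.
  have [Ai|iA] := leqP A i.
    by rewrite -(subnKC Ai) exprD -mulrA mulKf.
  rewrite -(subnKC iA) addSn exprS exprD.
  (* Since p / z = x w, a factor with the negative exponent i - A is a monomial times the factor
     with exponent A - i - 1 covered by [xw_unit]. *)
  have -> : 1 - z / (p * (p ^+ i * p ^+ (A - i.+1))) * p ^+ i
     = - (z / (p * p ^+ (A - i.+1))) * (1 - x * w * p ^+ (A - i.+1)).
    move: (pn0 i) (pn0 (A - i.+1)%N).
    move: (p ^+ i) (p ^+ (A - i.+1)) => a b a0 b0.
    by rewrite pE; field; rewrite ?a0 ?b0 ?x0 ?z0 ?w0.
  rewrite mulf_neq0 ?xw_unit // oppr_eq0 mulf_neq0 // invr_eq0.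
  by rewrite mulf_neq0.
have pE' : p = x * (z * w) by rewrite pE mulrA.
have := pf_unilateral pE' p_unit (A + B) zA.
rewrite -addnS mulrA !qpoch_shift // ?mulf_neq0 //.
rewrite big_split_ord /=.
have -> : p / (x * z) = w by rewrite pE; field; rewrite x0 z0.
have -> : p / z = x * w by rewrite pE; field.
have c0 : \prod_(i < A) - (p ^+ i.+1)^-1 != 0.
  by rewrite prodf_seq_neq0; apply/allP=> i _; rewrite oppr_eq0 invr_eq0 pn0.
move=> E; apply: (mulfI (expf_neq0 A x0)); rewrite mulrBr addrC.
transitivity (poch (x * z) B
  * ((x * z) ^+ A * \prod_(i < A) - p ^- i.+1 * poch w A)
  / (poch z B.+1 * (z ^+ A * \prod_(i < A) - p ^- i.+1 * poch (x * w) A))).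
  rewrite -E; congr (_ + _).
    (* Positions below A are the negative indices: reversal sends position A - m - 1 to k = - m - 1.
       The powers of p coming from the denominators are then split by p^j = x^j (z w)^j. *)
    rewrite (reindex_inj rev_ord_inj) /= mulrA mulr_sumr -sumrN.
    apply: eq_bigr => -[m mA] _ /=.
    have [j Ej] : exists j, A = (m + j).+1 by exists (A - m.+1)%N; rewrite -addSn subnKC.
    have -> : (A - m.+1 = j)%N by rewrite Ej subSS addKn.
    have -> : (A - j.+1 = m)%N by rewrite Ej subSS addnK.
    have -> : (A + B - m = B + j.+1)%N.
      by rewrite Ej -addnS -addnA addKn addnC.
    have -> : x ^+ A = x ^+ m * x ^+ j * x by rewrite Ej exprSr exprD.
    have -> : 1 - z / p ^+ A * p ^+ m
        = - (z / (p * p ^+ j)) * (1 - x * w * p ^+ j).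
      rewrite Ej exprS exprD.
      move: (pn0 j) (pn0 m); move: (p ^+ j) (p ^+ m) => a b a0 b0.
      by rewrite pE; field; rewrite ?a0 ?b0 ?x0 ?z0 ?w0.
    have pj : p ^+ j = x ^+ j * (z * w) ^+ j by rewrite -exprMn mulrA -pE.
    move: (xw_unit j) (pn0 j) (qpoch_neq0 m p_unit)
      (qpoch_neq0 (B + j.+1) p_unit); rewrite pj mulf_eq0 negb_or.
    move: (poch p m) (poch p (B + j.+1)) (poch x (B + j.+1)) (poch (z * w) m).
    move: (x ^+ j) ((z * w) ^+ j) (x ^+ m); rewrite pE.
    move=> a b c d e f g h1 /andP[h2 h3] h4 h5.
    by field; rewrite ?h1 ?h2 ?h3 ?h4 ?h5 ?x0 ?z0 ?w0 oppr_eq0 oner_eq0.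
  rewrite mulr_sumr; apply: eq_bigr => i _.
  have -> : z / p ^+ A * p ^+ (A + i) = z * p ^+ i by rewrite exprD -mulrA mulKf.
  by rewrite subnDl exprD !mulrA.
have zp0 := qpoch_neq0 B.+1 z_unit; have xwp0 := qpoch_neq0 A xw_unit.
rewrite exprMn; field.
by rewrite zp0 xwp0 c0 expf_neq0.
Qed.
End BilateralPartialFractions.

(** * Congruences modulo powers of q *)

(* O plays the role of the fractions that are power series in q. *)
Record local_subring (F : fieldType) (q : F) (O : F -> Prop) : Prop := {
  unif_neq0 : q != 0;
  O_unif : O q;
  O_1 : O 1;
  O_B : forall a b, O a -> O b -> O (a - b);
  O_M : forall a b, O a -> O b -> O (a * b);
  O_principal_unit : forall a, O a -> 1 + q * a != 0 /\ O (1 + q * a)^-1 }.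

Section Congruences.
Variables (F : fieldType) (q : F) (O : F -> Prop).
Hypothesis (OP : local_subring q O).

Definition divby n a := O (a / q ^+ n).
Definition eqm n a b := divby n (a - b).
Definition Ounit a := [/\ a != 0, O a & O a^-1].

Let qn0 n : q ^+ n != 0. Proof. by rewrite expf_neq0 // (unif_neq0 OP). Qed.

Lemma O0 : O 0. Proof. by rewrite -(subrr 1); apply: (O_B OP); apply: (O_1 OP). Qed.
Lemma ON a : O a -> O (- a).
Proof. by move=> ha; rewrite -sub0r; apply: (O_B OP) => //; apply: O0. Qed.
Lemma OD a b : O a -> O b -> O (a + b).
Proof. by move=> ha hb; rewrite -[b]opprK; apply: (O_B OP) => //; apply: ON. Qed.
Lemma OX a n : O a -> O (a ^+ n).
Proof.
move=> ha; elim: n => [|n IH]; first by rewrite expr0; apply: (O_1 OP).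
by rewrite exprS; apply: (O_M OP).
Qed.
Lemma Osum I (r : seq I) (P : pred I) (f : I -> F) :
  (forall i, P i -> O (f i)) -> O (\sum_(i <- r | P i) f i).
Proof. by move=> h; elim/big_ind: _ => //; [apply: O0 | apply: OD]. Qed.
Lemma Oprod I (r : seq I) (P : pred I) (f : I -> F) :
  (forall i, P i -> O (f i)) -> O (\prod_(i <- r | P i) f i).
Proof. by move=> h; elim/big_ind: _ => //; [apply: (O_1 OP) | apply: (O_M OP)]. Qed.

Lemma divby0 n : divby n 0. Proof. by rewrite /divby mul0r; apply: O0. Qed.
Lemma divbyD n a b : divby n a -> divby n b -> divby n (a + b).
Proof. by rewrite /divby mulrDl; apply: OD. Qed.
Lemma divbyN n a : divby n a -> divby n (- a).
Proof. by rewrite /divby mulNr; apply: ON. Qed.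
Lemma divbyM m n a b : divby m a -> divby n b -> divby (m + n) (a * b).
Proof. by rewrite /divby exprD invfM mulrACA; apply: (O_M OP). Qed.
Lemma divby_O a : divby 0 a <-> O a.
Proof. by rewrite /divby expr0 invr1 mulr1. Qed.
Lemma divbyMr n a b : O a -> divby n b -> divby n (a * b).
Proof. by move=> /divby_O ha hb; rewrite -[n]add0n; apply: divbyM. Qed.
Lemma divbyMl n a b : divby n a -> O b -> divby n (a * b).
Proof. by rewrite mulrC => ha hb; apply: divbyMr. Qed.
Lemma divbyX n a k : divby n a -> divby (n * k) (a ^+ k).
Proof.
move=> ha; elim: k => [|k IH]; first by rewrite muln0 expr0; apply/divby_O/(O_1 OP).
by rewrite exprS mulnS; apply: divbyM.
Qed.
Lemma divby_leq m n a : (m <= n)%N -> divby n a -> divby m a.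
Proof.
move=> mn; rewrite /divby -{1}(subnK mn) exprD => h.
have -> : a / q ^+ m = a / (q ^+ (n - m) * q ^+ m) * q ^+ (n - m).
  by rewrite invfM mulrA mulrAC divfK // mulrAC divfK.
by apply: (O_M OP) => //; apply: OX; apply: (O_unif OP).
Qed.
Lemma divby_isO n a : divby n a -> O a.
Proof. by move=> h; apply/divby_O; apply: divby_leq h. Qed.
Lemma divby_unif n : divby n (q ^+ n).
Proof. by rewrite /divby divff //; apply: (O_1 OP). Qed.

Lemma eqm_refl n a : eqm n a a. Proof. by rewrite /eqm subrr; apply: divby0. Qed.
Lemma eqm_sym n a b : eqm n a b -> eqm n b a.
Proof. by rewrite /eqm -opprB => h; rewrite -[_ - _]opprK; apply: divbyN. Qed.
Lemma eqm_trans n b a c : eqm n a b -> eqm n b c -> eqm n a c.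
Proof. by move=> h1 h2; rewrite /eqm -(subrK b a) -addrA; apply: divbyD. Qed.
Lemma eqmD n a b c d : eqm n a b -> eqm n c d -> eqm n (a + c) (b + d).
Proof. by rewrite /eqm opprD addrACA; apply: divbyD. Qed.
Lemma eqmN n a b : eqm n a b -> eqm n (- a) (- b).
Proof. by rewrite /eqm -opprD; apply: divbyN. Qed.
Lemma eqmB n a b c d : eqm n a b -> eqm n c d -> eqm n (a - c) (b - d).
Proof. by move=> h1 h2; apply: eqmD => //; apply: eqmN. Qed.
Lemma eqmM n a b c d : O b -> O c -> eqm n a b -> eqm n c d -> eqm n (a * c) (b * d).
Proof.
move=> hb hc h1 h2; rewrite /eqm.
have -> : a * c - b * d = (a - b) * c + b * (c - d) by ring.
by apply: divbyD; [apply: divbyMl | apply: divbyMr].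
Qed.
Lemma eqmMl n a b c : O a -> eqm n b c -> eqm n (a * b) (a * c).
Proof. by move=> ha h; rewrite /eqm -mulrBr; apply: divbyMr. Qed.
Lemma eqmMr n a b c : O c -> eqm n a b -> eqm n (a * c) (b * c).
Proof. by move=> ha h; rewrite /eqm -mulrBl; apply: divbyMl. Qed.
Lemma eqm_leq m n a b : (m <= n)%N -> eqm n a b -> eqm m a b.
Proof. exact: divby_leq. Qed.
Lemma eqm_sum n I (r : seq I) (P : pred I) (f g : I -> F) :
  (forall i, P i -> eqm n (f i) (g i)) ->
  eqm n (\sum_(i <- r | P i) f i) (\sum_(i <- r | P i) g i).
Proof.
move=> h; elim/big_ind2: _ => //; first exact: eqm_refl.
by move=> a b c d; apply: eqmD.
Qed.
Lemma eqm_prod n I (r : seq I) (P : pred I) (f g : I -> F) :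
  (forall i, P i -> O (f i)) -> (forall i, P i -> O (g i)) ->
  (forall i, P i -> eqm n (f i) (g i)) ->
  eqm n (\prod_(i <- r | P i) f i) (\prod_(i <- r | P i) g i).
Proof.
move=> hf hg h.
suff [] : [/\ eqm n (\prod_(i <- r | P i) f i) (\prod_(i <- r | P i) g i),
  O (\prod_(i <- r | P i) f i) & O (\prod_(i <- r | P i) g i)] by [].
elim/big_ind2: _ => [|a b c d [h1 h2 h3] [h4 h5 h6]|i Pi].
- by split; [apply: eqm_refl | apply: (O_1 OP) | apply: (O_1 OP)].
- by split; [apply: eqmM | apply: (O_M OP) | apply: (O_M OP)].
- by split; [apply: h | apply: hf | apply: hg].
Qed.
Lemma eqm_O n a b : eqm n a b -> O a -> O b.
Proof.
by move=> /divby_isO h ha; rewrite -(subKr a b); apply: (O_B OP).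
Qed.

Lemma Ounit1 : Ounit 1.
Proof. by split; rewrite ?oner_eq0 ?invr1 //; apply: (O_1 OP). Qed.
Lemma OunitM a b : Ounit a -> Ounit b -> Ounit (a * b).
Proof.
move=> [a0 Oa Oa'] [b0 Ob Ob']; split; rewrite ?mulf_neq0 ?invfM //.
- exact: (O_M OP).
- exact: (O_M OP).
Qed.
Lemma OunitV a : Ounit a -> Ounit a^-1.
Proof. by move=> [a0 Oa Oa']; split; rewrite ?invr_eq0 ?invrK. Qed.
Lemma Ounit_prod I (r : seq I) (P : pred I) (f : I -> F) :
  (forall i, P i -> Ounit (f i)) -> Ounit (\prod_(i <- r | P i) f i).
Proof. by move=> h; elim/big_ind: _ => //; [apply: Ounit1 | apply: OunitM]. Qed.
Lemma Ounit_1B a : divby 1 a -> Ounit (1 - a).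
Proof.
rewrite /divby expr1 => h; have q0 := unif_neq0 OP.
have -> : 1 - a = 1 + q * - (a / q) by field.
have [|h1 h2] := O_principal_unit OP (a := - (a / q)); first exact: ON.
split=> //; apply: OD; first exact: (O_1 OP).
by apply: (O_M OP); [apply: (O_unif OP) | apply: ON].
Qed.
Lemma Ounit_OV a : Ounit a -> O a^-1. Proof. by case. Qed.
Lemma Ounit_neq0 a : Ounit a -> a != 0. Proof. by case. Qed.
Lemma eqmV n a b : Ounit a -> Ounit b -> eqm n a b -> eqm n a^-1 b^-1.
Proof.
move=> [a0 Oa Oa'] [b0 Ob Ob'] h; rewrite /eqm.
have -> : a^-1 - b^-1 = a^-1 * b^-1 * (b - a) by field; rewrite a0 b0.
by apply: divbyMr; [apply: (O_M OP) | apply: eqm_sym].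
Qed.
Lemma eqm_cancel n a b c : Ounit c -> eqm n (c * a) (c * b) -> eqm n a b.
Proof.
move=> [c0 Oc Oc'] h; rewrite -[a](mulKf c0) -[b](mulKf c0).
exact: eqmMl.
Qed.

End Congruences.

(** * Kronecker's identity modulo q^N *)

Section Kronecker.
Variables (F : fieldType) (q : F) (O : F -> Prop).
Hypothesis (OP : local_subring q O).
Local Notation divby := (divby q O).
Local Notation eqm := (eqm q O).
Local Notation Ounit := (Ounit O).

Lemma O_qpoch p a n : O p -> O a -> O (qpoch p a n).
Proof.
move=> hp ha; apply: (Oprod OP) => i _; apply: (O_B OP); first exact: (O_1 OP).
by apply: (O_M OP) => //; apply: (OX OP).
Qed.

Lemma Ounit_qpoch p a n : O p -> divby 1 a -> Ounit (qpoch p a n).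
Proof.
move=> hp ha; apply: (Ounit_prod OP) => i _; apply: (Ounit_1B OP).
by apply: (divbyMl OP) => //; apply: (OX OP).
Qed.

Lemma eqm_qpoch N p a m n : divby 1 p -> O a -> (N <= m)%N -> (m <= n)%N ->
  eqm N (qpoch p a m) (qpoch p a n).
Proof.
move=> hp ha Nm /subnKC <-; elim: (n - m)%N => [|j IH].
  by rewrite addn0; apply: (eqm_refl OP).
apply: (eqm_trans OP IH).
rewrite addnS qpochS -[X in eqm _ X _]mulr1.
have hpO : O p by apply: (divby_isO OP) hp.
apply: (eqmMl OP); first exact: O_qpoch.
rewrite /eqm opprB addrC subrK; apply: (divbyMr OP) => //.
apply: (divby_leq OP (n := 1 * (m + j))); last exact: (divbyX OP).
by rewrite mul1n (leq_trans Nm) // leq_addr.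
Qed.

Section BilateralSum.
Variables (p x z w : F) (N : nat).
Hypotheses (pE : p = x * z * w) (p0 : p != 0) (z1 : 1 - z != 0).
Hypotheses (hx : divby 1 x) (hy : divby 1 (z * w)) (hxw : divby 1 (x * w)).
Hypotheses (hz : O z) (hw : O w).
Let L := (N + N)%N.

(* The factor 1 - z keeps the case z = -1, where 1 - z = 2 is not a unit of O. *)
Lemma kronecker_sum :
  eqm N (\sum_(k < L.+1) x ^+ k * ((1 - z) / (1 - z * p ^+ k))
         - (1 - z) * w * \sum_(m < L) (z * w) ^+ m / (1 - x * w * p ^+ m))
    (qpoch p p L ^+ 2 * qpoch p (x * z) L * qpoch p w L
     / (qpoch p x L * qpoch p (z * w) L * qpoch p (z * p) L * qpoch p (x * w) L)).
Proof.
have hp : divby 1 p by rewrite pE -mulrA; apply: (divbyMl OP) => //; apply: (divby_isO OP) hy.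
have Op := divby_isO OP hp; have Ox := divby_isO OP hx; have Oy := divby_isO OP hy.
have Oxw := divby_isO OP hxw.
have uB a i : divby 1 a -> Ounit (1 - a * p ^+ i).
  by move=> ha; apply: (Ounit_1B OP); apply: (divbyMl OP) => //; apply: (OX OP).
have hzp : divby 1 (z * p) by apply: (divbyMr OP).
have z_unit i : 1 - z * p ^+ i != 0.
  case: i => [|i]; first by rewrite expr0 mulr1.
  by rewrite exprS mulrA; case: (uB (z * p) i hzp).
have E := pf_bilateral pE p0 (fun i => Ounit_neq0 (uB p i hp)) z_unit
  (fun i => Ounit_neq0 (uB (x * w) i hxw)) L L.
have NL : (N <= L)%N by rewrite leq_addr.
have U a n : divby 1 a -> Ounit (qpoch p a n) by apply: Ounit_qpoch.
(* Modulo q^N all coefficients of the finite bilateral sum may be replaced by [c]: the term of index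
   k carries a multiple of q^k, so only k < N matters, and then all lengths involved are at least N.
   This is why L = 2 N. *)
pose c := qpoch p x L * qpoch p (z * w) L / (qpoch p p L * qpoch p p L).
have cU : Ounit c.
  by apply: (OunitM OP); [|apply: OunitV]; apply: (OunitM OP); apply: U.
have coef n1 n2 n3 n4 : (N <= n1)%N -> (N <= n2)%N -> (N <= n3)%N -> (N <= n4)%N ->
    eqm N c (qpoch p x n1 * qpoch p (z * w) n2 / (qpoch p p n3 * qpoch p p n4)).
  have S a n : divby 1 a -> (N <= n)%N -> eqm N (qpoch p a L) (qpoch p a n).
    move=> ha Nn; have [Ln|/ltnW nL] := leqP L n.
      by apply: eqm_qpoch => //; apply: (divby_isO OP) ha.
    by apply: (eqm_sym OP); apply: eqm_qpoch => //; apply: (divby_isO OP) ha.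
  move=> h1 h2 h3 h4; apply: (eqmM OP).
  - by apply: (O_M OP); apply: O_qpoch.
  - by apply: Ounit_OV; apply: (OunitM OP); apply: U.
  - by apply: (eqmM OP); (try by apply: O_qpoch); apply: S.
  - apply: (eqmV OP); try (by apply: (OunitM OP); apply: U).
    by apply: (eqmM OP); (try by apply: O_qpoch); apply: S.
have term a k C d : divby 1 a -> O C -> O d -> ((k < N)%N -> eqm N c C) ->
    eqm N (c * (a ^+ k * d)) (C * (a ^+ k * d)).
  move=> ha hC hd hcC; have Oak : O (a ^+ k) by apply: (OX OP); apply: (divby_isO OP) ha.
  have [kN|Nk] := ltnP k N; first by apply: (eqmMr OP); [apply: (O_M OP) | apply: hcC].
  rewrite /eqm -mulrBl; apply: (divbyMr OP).
    by apply: (O_B OP) => //; case: cU.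
  apply: (divbyMl OP) => //; apply: (divby_leq OP (n := 1 * k)); first by rewrite mul1n.
  exact: (divbyX OP).
have rearr (a b e d f : F) : a * b * e / d / f = b * e / d * (a / f) by ring.
have LpN k : (N <= L + k)%N by rewrite /L -addnA leq_addr.
have LmN k : (k <= N)%N -> (N <= L - k)%N by move=> kN; rewrite /L -addnBA // leq_addr.
have OC n1 n2 n3 n4 :
    O (qpoch p x n1 * qpoch p (z * w) n2 / (qpoch p p n3 * qpoch p p n4)).
  apply: (O_M OP); first by apply: (O_M OP); apply: O_qpoch.
  by apply: Ounit_OV; apply: (OunitM OP); apply: U.
apply: (eqm_cancel OP cU).
apply: (eqm_trans OP (b := (1 - z) * (qpoch p (x * z) L * qpoch p w L
    / (qpoch p z L.+1 * qpoch p (x * w) L)))); last first.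
  have [u1 _ _] := U x L hx; have [u2 _ _] := U _ L hy.
  have [u3 _ _] := U _ L hxw; have [u4 _ _] := U _ L hp; have [u5 _ _] := U _ L hzp.
  rewrite qpoch_head.
  set lhs := (X in eqm _ X _); set rhs := (X in eqm _ _ X).
  suff -> : lhs = rhs by apply: (eqm_refl OP).
  rewrite /lhs /rhs /c; field.
  by rewrite u1 u2 u3 u4 u5 z1.
rewrite -E mulrBr mulrBr [c * _ in X in eqm _ X _]mulr_sumr.
rewrite [(1 - z) * (w * _)]mulrA [c * (_ * _)]mulrCA.
apply: (eqmB OP).
  rewrite mulr_sumr; apply: (eqm_sum OP) => -[k /=]; rewrite ltnS => kL _.
  rewrite rearr [(1 - z) * (_ * (x ^+ k / _))]mulrCA [(1 - z) * (x ^+ k / _)]mulrCA.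
  apply: term => //.
    have [->|k0] := posnP k; first by rewrite expr0 mulr1 divff //; apply: (O_1 OP).
    rewrite -(prednK k0) exprS mulrA; apply: (O_M OP); last by case: (uB _ k.-1 hzp).
    by apply: (O_B OP) => //; apply: (O_1 OP).
  by move=> kN; apply: coef; rewrite ?LpN ?LmN // ltnW.
apply: (eqmMl OP).
  by apply: (O_M OP) => //; apply: (O_B OP) => //; apply: (O_1 OP).
rewrite mulr_sumr; apply: (eqm_sum OP) => -[m /= mL] _.
rewrite rearr; apply: term => //; first by case: (uB _ m hxw).
by move=> mN; apply: coef; rewrite ?LpN ?LmN.
Qed.
End BilateralSum.
End Kronecker.

(** * Kronecker's identity at z = - 1 *)

Section Specialisations.
Variables (F : fieldType) (q : F) (O : F -> Prop).
Hypothesis (OP : local_subring q O).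
Local Notation divby := (divby q O).
Local Notation eqm := (eqm q O).
Local Notation Ounit := (Ounit O).

Let O1 := O_1 OP.
Let Oq := O_unif OP.
Let q0 := unif_neq0 OP.

Lemma Oq_exp n : O (q ^+ n). Proof. exact: (OX OP). Qed.

Lemma divby_q n c m : (m <= n)%N -> O c -> divby m (c * q ^+ n).
Proof.
move=> mn hc; apply: (divbyMr OP) => //; apply: (divby_leq OP mn).
exact: (divby_unif OP).
Qed.

Lemma eqm_geometric N v J : divby 1 v -> (N <= J)%N ->
  eqm N (1 - v)^-1 (\sum_(j < J) v ^+ j).
Proof.
move=> hv NJ; have [u0 Ou OuV] := Ounit_1B OP hv.
have -> : (1 - v)^-1 = \sum_(j < J) v ^+ j + (1 - v)^-1 * v ^+ J.
  apply: (mulfI u0); rewrite mulrDr mulrA divff // mul1r.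
  have := subrX1 v J; rewrite -opprB -[v - 1]opprB mulNr => /oppr_inj <-.
  by rewrite subrK.
rewrite /eqm addrC addKr; apply: (divbyMr OP) => //.
by apply: (divby_leq OP (n := 1 * J)); [rewrite mul1n | apply: (divbyX OP)].
Qed.

(** Left as a double series because it is resummed both ways: over j it gives the terms of
    Kronecker's identity with denominators 1 + q^(3 (k + 1)), over k the logarithmic derivatives of
    the products in base q^6. *)
Definition lambert K J := \sum_(k < K) \sum_(j < J) (-1) ^+ (k.+1 + j)
  * (q ^+ (k.+1 * (3 * j + 1)) + q ^+ (k.+1 * (3 * j + 2))).

Lemma lambert_product N J (L := (N + N)%N) : (2 : F) != 0 -> (N <= J)%N ->
  eqm N (1 + 2 * lambert L J)
    (qpoch (q ^+ 3) (q ^+ 3) L ^+ 2 * qpoch (q ^+ 3) q L * qpoch (q ^+ 3) (q ^+ 2) L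
     / (qpoch (q ^+ 3) (- q) L * qpoch (q ^+ 3) (- q ^+ 2) L
        * qpoch (q ^+ 3) (- q ^+ 3) L * qpoch (q ^+ 3) (- q ^+ 3) L)).
Proof.
move=> two0 NJ.
have pE : q ^+ 3 = - q * (-1) * q ^+ 2 by ring.
have p0 : q ^+ 3 != 0 by rewrite expf_neq0.
have z1 : 1 - (-1) != 0 :> F by rewrite opprK.
have hx : divby 1 (- q) by rewrite -mulN1r -[q]expr1; apply: divby_q => //; apply: (ON OP).
have hy : divby 1 (-1 * q ^+ 2) by apply: divby_q => //; apply: (ON OP).
have hxw : divby 1 (- q * q ^+ 2).
  by rewrite mulNr -mulN1r -exprS; apply: divby_q => //; apply: (ON OP).
have hz : O (-1) by apply: (ON OP).
have := kronecker_sum OP N pE p0 z1 hx hy hxw hz (Oq_exp 2).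
have -> : - q * -1 = q by rewrite mulrN1 opprK.
have -> : - q * q ^+ 2 = - q ^+ 3 by rewrite mulNr -exprS.
rewrite !mulN1r opprK -[(N + N)%N]/L.
apply: (eqm_trans OP).
(* The term k = 0 is (1 - z) / (1 - z) = 1, the constant term of [1 + 2 * lambert]; all other
   denominators are units of [O]. *)
rewrite big_ord_recl /= !expr0 mulr1 opprK divff // mul1r -addrA.
apply: (eqmD OP); first exact: (eqm_refl OP).
rewrite /lambert [X in 2 * X](_ : _ = \sum_(k < L) ((- q) ^+ k.+1
    * (\sum_(j < J) (- q ^+ (3 * k.+1)) ^+ j)) - \sum_(k < L) (q ^+ 2 * ((- q ^+ 2) ^+ k
    * \sum_(j < J) (- q ^+ (3 * k.+1)) ^+ j))); last first.
  rewrite -sumrB; apply: eq_bigr => k _.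
  rewrite !mulr_sumr -sumrB; apply: eq_bigr => j _.
  rewrite mulrDr; congr (_ + _).
    rewrite (exprNn q) (exprNn (q ^+ _)) -exprM mulrACA -!exprD.
    by congr (_ * q ^+ _); ring.
  rewrite 2!(exprNn (q ^+ _)) -!exprM [_ * _ * (_ ^+ j * _)]mulrACA -!exprD.
  rewrite [q ^+ 2 * _]mulrCA -exprD.
  by rewrite addSn exprS mulN1r mulNr; congr (- (_ * q ^+ _)); ring.
have hv k : divby 1 (- q ^+ (3 * k.+1)).
  by rewrite -mulN1r; apply: divby_q => //; rewrite mulnS.
rewrite mulrBr -mulrA; apply: (eqmB OP).
  rewrite mulr_sumr; apply: (eqm_sum OP) => k _.
  rewrite mulrCA /bump add1n; apply: (eqmMl OP); first by apply: (OX OP); apply: (ON OP).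
  rewrite mulN1r -exprM; apply: (eqmMl OP); first exact: (OD OP).
  by apply: (eqm_sym OP); apply: eqm_geometric.
apply: (eqmMl OP); first exact: (OD OP).
rewrite -[X in eqm _ X _]mulr_sumr; apply: (eqmMl OP); first exact: Oq_exp.
apply: (eqm_sum OP) => k _; apply: (eqmMl OP).
  by apply: (OX OP); apply: (ON OP); apply: Oq_exp.
apply: (eqm_sym OP); rewrite mulNr -exprS -exprM; exact: eqm_geometric.
Qed.
End Specialisations.

(** * The double series with the parameter t *)

Section Deformation.
Variables (F : fieldType) (q : F) (O : F -> Prop).
Hypothesis (OP : local_subring q O).
Local Notation divby := (divby q O).
Local Notation eqm := (eqm q O).
Local Notation Ounit := (Ounit O).
Local Notation Oq := (Oq_exp OP).
Local Notation poch := (qpoch (q ^+ 6)).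

(** The halves k >= 0 and k < 0 of the bilateral sum, multiplied by t, with every denominator
    expanded as a geometric series. *)
Definition double_sum (t : F) L :=
  \sum_(k < L) \sum_(m < L) (-1) ^+ (k + m) * t ^+ (2 * (k + m) + 1)
     * q ^+ (6 * k * m + 2 * k + m)
  - \sum_(m < L) \sum_(k < L) (-1) ^+ (k + m) * t ^- (2 * (k + m) + 3)
     * q ^+ (6 * k * m + 4 * m + 5 * k + 3).

(** This is (p; p)^2 theta (x z) / (theta x theta z) with theta a = (a; p) (p / a; p), p = q^6, x =
    - t^2 q^2 and z = - t^2 q. *)
Definition theta_quotient (t : F) L :=
  poch (q ^+ 6) L ^+ 2 * poch (t ^+ 4 * q ^+ 3) L * poch (t ^- 4 * q ^+ 3) L
  / (poch (- (t ^+ 2 * q ^+ 2)) L * poch (- (t ^- 2 * q ^+ 4)) L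
     * poch (- (t ^+ 2 * q)) L * poch (- (t ^- 2 * q ^+ 5)) L).

Lemma double_sum_product N t (L := (N + N)%N) : Ounit t ->
  eqm N (double_sum t L) (t * theta_quotient t L).
Proof.
move=> [t0 Ot OtV].
have OtX n : O (t ^+ n) by apply: (OX OP).
have OtVX n : O (t ^- n) by rewrite -exprVn; apply: (OX OP).
have NL : (N <= L)%N by rewrite leq_addr.
have dq c n : O c -> divby 1 (- (c * q ^+ n.+1)).
  by move=> hc; apply: (divbyN OP); apply: (divby_q OP).
pose x := - (t ^+ 2 * q ^+ 2); pose z := - (t ^+ 2 * q); pose w := t ^- 4 * q ^+ 3.
have pE : q ^+ 6 = x * z * w by rewrite /x /z /w; field.
have p0 : q ^+ 6 != 0 by rewrite expf_neq0 // (unif_neq0 OP).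
have hx : divby 1 x by apply: dq.
have hz : divby 1 z by rewrite /z -[q]expr1; apply: dq.
have yE : z * w = - (t ^- 2 * q ^+ 4) by rewrite /z /w; field.
have xwE : x * w = - (t ^- 2 * q ^+ 5) by rewrite /x /w; field.
have xzE : x * z = t ^+ 4 * q ^+ 3 by rewrite /x /z; ring.
have hy : divby 1 (z * w) by rewrite yE; apply: dq.
have hxw : divby 1 (x * w) by rewrite xwE; apply: dq.
have zU := Ounit_1B OP hz; have [z1 Oz1 OzV1] := zU.
have Ow : O w by apply: (O_M OP) => //; apply: Oq.
have := kronecker_sum OP N pE p0 z1 hx hy hxw (divby_isO OP hz) Ow.
rewrite -[(N + N)%N]/L yE xwE xzE => kron.
(* Here z is divisible by q, so 1 - z is a unit and the factor 1 - z of [kronecker_sum] can be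
   cancelled. *)
apply: (eqm_cancel OP zU).
have hp : divby 1 (q ^+ 6) by rewrite -[q ^+ 6]mul1r; apply: (divby_q OP) => //; apply: (O_1 OP).
have U a : divby 1 a -> Ounit (poch a L) by apply: (Ounit_qpoch OP); apply: Oq.
have hzp : divby 1 (z * q ^+ 6) by apply: (divbyMl OP hz); apply: Oq.
have hy' := hy; rewrite yE in hy'; have hxw' := hxw; rewrite xwE in hxw'.
have [u1 _ _] := U _ hx; have [u2 _ _] := U _ hy'; have [u3 _ _] := U _ hxw'.
have [u4 _ _] := U _ hzp.
apply: (eqm_trans OP (b := t * (qpoch (q ^+ 6) (q ^+ 6) L ^+ 2 * poch (t ^+ 4 * q ^+ 3) L
  * poch w L / (poch x L * poch (- (t ^- 2 * q ^+ 4)) L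
     * poch (z * q ^+ 6) L * poch (- (t ^- 2 * q ^+ 5)) L)))); last first.
  rewrite /theta_quotient -/x -/z -/w.
  set a1 := poch _ L; set a2 := poch _ L; set a3 := poch w L.
  move: u1 u2 u3 u4 (Ounit_neq0 (U _ hz)).
  set b1 := poch x L; set b2 := poch (- (t ^- 2 * q ^+ 4)) L.
  set b3 := poch (- (t ^- 2 * q ^+ 5)) L; set b4 := poch (z * _) L.
  set b5 := poch z L => u1 u2 u3 u4 u5.
  have -> : (1 - z) * (t * (a1 ^+ 2 * a2 * a3 / (b1 * b2 * b5 * b3)))
      = t * (a1 ^+ 2 * a2 * a3 / (b1 * b2 * b3) * (1 - z)) / b5.
    by field; rewrite u1 u2 u3 u5.
  have -> : t * (a1 ^+ 2 * a2 * a3 / (b1 * b2 * b4 * b3))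
      = t * (a1 ^+ 2 * a2 * a3 / (b1 * b2 * b3) * (1 - z)) / poch z L.+1.
    by rewrite qpoch_head -/b4; field; rewrite u1 u2 u3 u4 z1.
  have OP' a : O a -> O (poch a L) by apply: (O_qpoch OP); apply: Oq.
  apply: (eqmMl OP).
    apply: (O_M OP) => //; apply: (O_M OP); last by [].
    apply: (O_M OP).
      apply: (O_M OP); last by apply: OP'.
      apply: (O_M OP); first by apply: (OX OP); apply: OP'; apply: Oq.
      by apply: OP'; apply: (O_M OP) => //; apply: Oq.
    by apply: Ounit_OV; do 2 (apply: (OunitM OP); last by apply: U); apply: U.
  apply: (eqmV OP); try by apply: (Ounit_qpoch OP) => //; apply: Oq.
  apply: (eqm_sym OP); apply: (eqm_qpoch OP) => //; exact: (divby_isO OP) hz.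
apply: (eqm_trans OP (b := t * _)); last by apply: (eqmMl OP Ot); apply: kron.
rewrite /double_sum !mulrBr; apply: (eqmB OP).
  (* [kronecker_sum] has one more term, k = L, than [double_sum]; it is divisible by x^L, hence
     vanishes modulo q^N. *)
  rewrite big_ord_recr /= mulrDr -[X in eqm _ X _]addr0; apply: (eqmD OP).
    rewrite !mulr_sumr; apply: (eqm_sum OP) => k _.
    rewrite (_ : t * _ = (1 - z) * (t * x ^+ k * (1 - z * q ^+ 6 ^+ k)^-1)); last by ring.
    rewrite (_ : \sum_(m < L) _ = t * x ^+ k * \sum_(m < L) (z * q ^+ 6 ^+ k) ^+ m).
      apply: (eqmMl OP) => //; apply: (eqmMl OP).
        by apply: (O_M OP) => //; apply: (OX OP); apply: (divby_isO OP) hx.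
      apply: (eqm_sym OP); apply: (eqm_geometric OP) => //.
      by apply: (divbyMl OP) => //; rewrite -exprM; apply: Oq.
    rewrite mulr_sumr; apply: eq_bigr => m _.
    have -> : q ^+ (6 * k * m + 2 * k + m) = q ^+ 6 ^+ k ^+ m * q ^+ 2 ^+ k * q ^+ m.
      by rewrite (exprD _ (6 * k * m + 2 * k)) (exprD _ (6 * k * m)) (exprM _ (6 * k))
        (exprM _ 6) (exprM _ 2).
    have -> : t ^+ (2 * (k + m) + 1) = t ^+ 2 ^+ k * t ^+ 2 ^+ m * t.
      by rewrite (exprD _ _ 1) expr1 (exprM _ 2) (exprD _ k).
    rewrite /x /z; move: (q ^+ 6 ^+ k) (q ^+ 2) (t ^+ 2) => a b c.
    by rewrite exprD mulNr (exprNn (c * b)) (exprNn (c * q * a)) !exprMn; ring.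
  have hpL : divby 1 (z * q ^+ 6 ^+ L).
    by apply: (divbyMl OP) => //; rewrite -exprM; apply: Oq.
  apply: (eqm_sym OP); rewrite /eqm subr0; apply: (divbyMr OP) => //.
  apply: (divbyMl OP); last by apply: (O_M OP) => //; case: (Ounit_1B OP hpL).
  by apply: (divby_leq OP (n := 1 * L)); [rewrite mul1n | apply: (divbyX OP)].
rewrite mulrCA -mulrA; apply: (eqmMl OP) => //.
rewrite mulrCA mulr_sumr mulr_sumr; apply: (eqm_sum OP) => m _.
rewrite mulrA mulrA (_ : \sum_(k < L) _ = w * t * (- (t ^- 2 * q ^+ 4)) ^+ m
    * \sum_(k < L) (- (t ^- 2 * q ^+ 5) * q ^+ 6 ^+ m) ^+ k).
  rewrite [t * w]mulrC; apply: (eqmMl OP).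
    apply: (O_M OP); first exact: (O_M OP).
    by apply: (OX OP); apply: (divby_isO OP) hy'.
  apply: (eqm_sym OP); apply: (eqm_geometric OP) => //.
  by apply: (divbyMl OP) => //; rewrite -exprM; apply: Oq.
rewrite mulr_sumr; apply: eq_bigr => k _.
have -> : q ^+ (6 * k * m + 4 * m + 5 * k + 3)
    = q ^+ 6 ^+ m ^+ k * q ^+ 4 ^+ m * q ^+ 5 ^+ k * q ^+ 3.
  by rewrite (exprD _ _ 3) (exprD _ _ (5 * k)) (exprD _ (6 * k * m)) mulnAC (exprM _ (6 * m))
    (exprM _ 6) (exprM _ 4) (exprM _ 5).
have -> : t ^- (2 * (k + m) + 3) = t ^- 2 ^+ k * t ^- 2 ^+ m * t ^- 3.
  by rewrite (exprD _ _ 3) invfM (exprM _ 2) -exprVn (exprD _ k).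
have -> : w * t = t ^- 3 * q ^+ 3 by rewrite /w; field.
move: (q ^+ 6 ^+ m) (q ^+ 3) (q ^+ 4) (q ^+ 5) (t ^- 2) (t ^- 3) => a b c d e f.
by rewrite exprD mulNr (exprNn (e * c)) (exprNn (e * d * a)) !exprMn; ring.
Qed.
End Deformation.

(** * First-order expansion at t = 1 *)

(* The small power e = q^E is used as an infinitesimal: modulo q^(2E) it behaves
   as a dual number, so setting t = 1 + e differentiates at t = 1. *)
Section FirstOrder.
Variables (F : fieldType) (q : F) (O : F -> Prop).
Hypothesis (OP : local_subring q O).
Local Notation divby := (divby q O).
Local Notation eqm := (eqm q O).
Local Notation Ounit := (Ounit O).
Local Notation Oq := (Oq_exp OP).
Local Notation poch := (qpoch (q ^+ 6)).
Variable (E : nat).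
Hypothesis (E0 : (0 < E)%N).

Let O1 := O_1 OP.

Lemma Onat n : O n%:R.
Proof. by elim: n => [|n IH]; [apply: (O0 OP) | rewrite mulrSr; apply: (OD OP)]. Qed.

Lemma eqm_1DM a b : divby E a -> divby E b ->
  eqm (E + E) ((1 + a) * (1 + b)) (1 + (a + b)).
Proof.
move=> ha hb; rewrite /eqm.
have -> : (1 + a) * (1 + b) - (1 + (a + b)) = a * b by ring.
exact: (divbyM OP).
Qed.

Lemma Ounit_1D a : divby E a -> Ounit (1 + a).
Proof.
move=> ha; rewrite -[a]opprK; apply: (Ounit_1B OP).
by apply: (divbyN OP); apply: (divby_leq OP E0).
Qed.

Lemma eqm_1DV a : divby E a -> eqm (E + E) (1 + a)^-1 (1 - a).
Proof.
move=> ha; have u := Ounit_1D ha; apply: (eqm_cancel OP u).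
rewrite divff; last by case: u.
apply: (eqm_sym OP); have := eqm_1DM ha (divbyN OP ha).
by rewrite subrr addr0.
Qed.

Lemma eqm_1DX a n : divby E a -> eqm (E + E) ((1 + a) ^+ n) (1 + n%:R * a).
Proof.
move=> ha; elim: n => [|n IH]; first by rewrite expr0 mul0r addr0; apply: (eqm_refl OP).
have hn : divby E (n%:R * a) by apply: (divbyMr OP) => //; apply: Onat.
apply: (eqm_trans OP (b := (1 + a) * (1 + n%:R * a))).
  rewrite exprS; apply: (eqmMl OP) => //; apply: (OD OP) => //; exact: (divby_isO OP) ha.
have -> : n.+1%:R * a = a + n%:R * a by rewrite -natr1; ring.
exact: eqm_1DM.
Qed.

Lemma eqm_1DXV a n : divby E a -> eqm (E + E) ((1 + a) ^- n) (1 - n%:R * a).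
Proof.
move=> ha; have hn : divby E (n%:R * a) by apply: (divbyMr OP) => //; apply: Onat.
apply: (eqm_trans OP _ (eqm_1DV hn)).
apply: (eqmV OP); last exact: eqm_1DX.
- elim: n {hn} => [|n IH]; first by rewrite expr0; apply: (Ounit1 OP).
  by rewrite exprS; apply: (OunitM OP) => //; apply: Ounit_1D.
- exact: Ounit_1D.
Qed.

Lemma eqm_prod_1D n (d : 'I_n -> F) : (forall i, divby E (d i)) ->
  eqm (E + E) (\prod_i (1 + d i)) (1 + \sum_i d i).
Proof.
move=> hd; suff [] : [/\ eqm (E + E) (\prod_i (1 + d i)) (1 + \sum_i d i),
  O (\prod_i (1 + d i)) & divby E (\sum_i d i)] by [].
elim/big_ind2: _ => [|a b c e [h1 h2 h3] [h4 h5 h6]|i _].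
- by split; [rewrite addr0; apply: (eqm_refl OP) | | apply: (divby0 OP)].
- split; [|exact: (O_M OP)|exact: (divbyD OP)].
  apply: (eqm_trans OP _ (eqm_1DM h3 h6)); apply: (eqmM OP) => //.
  by apply: (eqm_O OP) h1 _.
- split=> //; [exact: (eqm_refl OP)|apply: (OD OP) => //; exact: (divby_isO OP) (hd i)].
Qed.

(** The derivative of [double_sum] in t at t = 1; the negative exponents of t turn the minus sign
    between the halves into a plus. *)
Definition weighted_sum L :=
  \sum_(k < L) \sum_(m < L) (-1) ^+ (k + m) * (2 * (k + m) + 1)%:R
     * q ^+ (6 * k * m + 2 * k + m)
  + \sum_(m < L) \sum_(k < L) (-1) ^+ (k + m) * (2 * (k + m) + 3)%:R
     * q ^+ (6 * k * m + 4 * m + 5 * k + 3).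

Let e := q ^+ E.
Let he : divby E e. Proof. exact: (divby_unif OP). Qed.

Lemma double_sum_first_order L :
  eqm (E + E) (double_sum q (1 + e) L) (double_sum q 1 L + e * weighted_sum L).
Proof.
have Osgn n : O ((-1) ^+ n) by apply: (OX OP); apply: (ON OP).
have expand (P Q : F) s : O P -> O Q -> forall c, eqm (E + E) c (1 + s%:R * e) ->
    eqm (E + E) (P * c * Q) (P * Q + e * (P * s%:R * Q)).
  move=> hP hQ c hc; rewrite (_ : _ + _ = P * (1 + s%:R * e) * Q); last by ring.
  by apply: (eqmMr OP) => //; apply: (eqmMl OP).
have expandV (P Q : F) s : O P -> O Q -> forall c, eqm (E + E) c (1 - s%:R * e) ->
    eqm (E + E) (P * c * Q) (P * Q - e * (P * s%:R * Q)).
  move=> hP hQ c hc; rewrite (_ : _ - _ = P * (1 - s%:R * e) * Q); last by ring.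
  by apply: (eqmMr OP) => //; apply: (eqmMl OP).
rewrite /double_sum /weighted_sum mulrDr addrACA; apply: (eqmD OP).
  rewrite mulr_sumr -big_split; apply: (eqm_sum OP) => k _.
  rewrite mulr_sumr -big_split; apply: (eqm_sum OP) => m _ /=.
  by rewrite expr1n mulr1; apply: expand => //; [apply: Oq | apply: eqm_1DX].
rewrite -[e * _]opprK -opprD; apply: (eqmN OP).
rewrite mulr_sumr -sumrB; apply: (eqm_sum OP) => m _.
rewrite mulr_sumr -sumrB; apply: (eqm_sum OP) => k _ /=.
by rewrite expr1n invr1 mulr1; apply: expandV => //; [apply: Oq | apply: eqm_1DXV].
Qed.

Definition logder a L := \sum_(i < L) q ^+ a * q ^+ 6 ^+ i / (1 + q ^+ a * q ^+ 6 ^+ i).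

Lemma O_logder a L : (0 < a)%N -> O (logder a L).
Proof.
move=> a0; apply: (Osum OP) => i _; rewrite -exprM -exprD.
apply: (O_M OP); first exact: Oq.
rewrite -[q ^+ _]opprK; case: (Ounit_1B OP (a := - q ^+ (a + 6 * i))) => //.
rewrite -mulN1r; apply: (divby_q OP); last exact: (ON OP).
by rewrite addn_gt0 a0.
Qed.

Lemma qpoch_deform a c L : (0 < a)%N -> divby E c ->
  eqm (E + E) (poch (- ((1 + c) * q ^+ a)) L)
    (poch (- q ^+ a) L * (1 + c * logder a L)).
Proof.
move=> a0 hc.
have u i : Ounit (1 + q ^+ a * q ^+ 6 ^+ i).
  rewrite -[q ^+ a * _]opprK; apply: (Ounit_1B OP); rewrite -exprM -exprD -mulN1r.
  by apply: (divby_q OP); [rewrite addn_gt0 a0 | apply: (ON OP)].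
rewrite /qpoch (_ : \prod_(i < L) _ = \prod_(i < L) (1 - - q ^+ a * q ^+ 6 ^+ i)
    * \prod_(i < L) (1 + c * (q ^+ a * q ^+ 6 ^+ i / (1 + q ^+ a * q ^+ 6 ^+ i)))).
  apply: (eqmMl OP).
    by apply: (Oprod OP) => i _; rewrite mulNr opprK; case: (u i).
  rewrite /logder mulr_sumr; apply: eqm_prod_1D => i.
  apply: (divbyMl OP) => //; apply: (O_M OP); last by case: (u i).
  by rewrite -exprM -exprD; apply: Oq.
rewrite -big_split; apply: eq_bigr => i _ /=; case: (u i) => u0 _ _.
rewrite !mulNr !opprK; move: u0; move: (q ^+ a) (q ^+ 6 ^+ i) => f g u0.
by field.
Qed.


Let t := 1 + e.
Let tU : Ounit t. Proof. exact: Ounit_1D. Qed.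

Let tXU n : Ounit (t ^+ n).
Proof.
elim: n => [|n IH]; first by rewrite expr0; apply: (Ounit1 OP).
by rewrite exprS; apply: (OunitM OP).
Qed.

Let tX_sub1 n : divby E (t ^+ n - 1).
Proof.
elim: n => [|n IH]; first by rewrite subrr; apply: (divby0 OP).
have -> : t ^+ n.+1 - 1 = t * (t ^+ n - 1) + e by rewrite exprS /t; ring.
by apply: (divbyD OP) => //; apply: (divbyMr OP) => //; case: tU.
Qed.

(** By the symmetry t -> 1 / t there is no first-order term: factor by factor the difference is a
    multiple of (t^4 - 1)^2, which q^(2 E) divides. *)
Lemma theta_numerator L :
  eqm (E + E) (poch (t ^+ 4 * q ^+ 3) L * poch (t ^- 4 * q ^+ 3) L) (poch (q ^+ 3) L ^+ 2).
Proof.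
have OtV : O (t ^- 4) by case: (tXU 4).
have [t40 Ot4 _] := tXU 4.
have Ou i : O (q ^+ 3 * q ^+ 6 ^+ i) by rewrite -exprM -exprD; apply: Oq.
rewrite /qpoch expr2 -!big_split /=; apply: (eqm_prod OP) => i _.
- rewrite -[t ^+ 4 * _ * _]mulrA -[t ^- 4 * _ * _]mulrA.
  by apply: (O_M OP); apply: (O_B OP) => //; apply: (O_M OP).
- by apply: (O_M OP); apply: (O_B OP).
rewrite -[t ^+ 4 * _ * _]mulrA -[t ^- 4 * _ * _]mulrA; move: (Ou i); set u := _ * _ => hu.
rewrite /eqm (_ : _ - _ = (t ^+ 4 - 1) * (t ^+ 4 - 1) * - (t ^- 4 * u)).
  apply: (divbyMl OP); first by apply: (divbyM OP).
  by apply: (ON OP); apply: (O_M OP).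
by move: (t ^+ 4) t40 => a a0; field.
Qed.

Definition logder_sum L := - logder 1 L - logder 2 L + logder 4 L + logder 5 L.

(** The leading t gives the 1 and the numerator gives nothing. Each denominator product contributes
    its [logder] times 2, with minus sign where t^2 occurs and plus sign where t^-2 occurs. *)
Lemma theta_quotient_first_order L :
  eqm (E + E) (t * theta_quotient q t L)
    (theta_quotient q 1 L * (1 + e * (1 + 2 * logder_sum L))).
Proof.
have hq a c : (0 < a)%N -> O c -> divby 1 (- (c * q ^+ a)).
  by move=> a0 hc; apply: (divbyN OP); apply: (divby_q OP).
have OtV : O (t ^- 2) by case: (tXU 2).
have Ot : O (t ^+ 2) by case: (tXU 2).
have U a c : (0 < a)%N -> O c -> Ounit (poch (- (c * q ^+ a)) L).
  by move=> a0 hc; apply: (Ounit_qpoch OP); [apply: Oq | apply: hq].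
have den a c s : (0 < a)%N -> divby E (c - 1) -> O s -> eqm (E + E) c (1 + s * e) ->
    eqm (E + E) (poch (- (c * q ^+ a)) L) (poch (- q ^+ a) L * (1 + s * e * logder a L)).
  move=> a0 hc hs ce.
  have := qpoch_deform L a0 hc; rewrite addrC subrK => h.
  apply: (eqm_trans OP h); apply: (eqmMl OP).
    by rewrite -[q ^+ a]mul1r; case: (U a 1 a0 O1).
  apply: (eqmD OP); first exact: (eqm_refl OP).
  apply: (eqmMr OP); first exact: O_logder.
  by rewrite /eqm -addrA -opprD; apply: ce.
have e2 : eqm (E + E) (t ^+ 2) (1 + 2 * e) by exact: eqm_1DX.
have e2' : eqm (E + E) (t ^- 2) (1 + (- 2) * e) by rewrite mulNr; exact: eqm_1DXV.
have t2V : divby E (t ^- 2 - 1).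
  have [t20 _ _] := tXU 2.
  rewrite (_ : _ - _ = (t ^+ 2 - 1) * - t ^- 2); last by move: (t ^+ 2) t20 => a a0; field.
  by apply: (divbyMl OP) => //; apply: (ON OP).
have O2 : O 2 by exact: (Onat 2).
have OS a : (0 < a)%N -> O (logder a L) by exact: O_logder.
have d1 := den 1 _ 2 isT (tX_sub1 2) O2 e2; have d2 := den 2%N _ 2 isT (tX_sub1 2) O2 e2.
have d4 := den 4%N _ (- 2) isT t2V (ON OP O2) e2'.
have d5 := den 5%N _ (- 2) isT t2V (ON OP O2) e2'.
have U1 a : (0 < a)%N -> Ounit (poch (- q ^+ a) L).
  by move=> a0; have := U a 1 a0 O1; rewrite mul1r.
have se s a : (0 < a)%N -> O s -> divby E (s * e * logder a L).
  by move=> a0 hs; apply: (divbyMl OP); [apply: (divbyMr OP) | apply: OS].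
have mulden a b c d x y : eqm (E + E) a (b * (1 + x)) -> eqm (E + E) c (d * (1 + y)) ->
    O b -> O c -> O d -> divby E x -> divby E y ->
    eqm (E + E) (a * c) (b * d * (1 + (x + y))).
  move=> h1 h2 hb hc hd hx hy.
  have O1D v : divby E v -> O (1 + v) by move=> hv; case: (Ounit_1D hv).
  apply: (eqm_trans OP (eqmM OP _ hc h1 h2)); first by apply: (O_M OP) => //; apply: O1D.
  by rewrite mulrACA; apply: (eqmMl OP); [exact: (O_M OP) | exact: eqm_1DM].
have Opoch a : (0 < a)%N -> O (poch (- q ^+ a) L) by move=> a0; case: (U1 a a0).
have Opocht a c : (0 < a)%N -> O c -> O (poch (- (c * q ^+ a)) L).
  by move=> a0 hc; case: (U a c a0 hc).
have seN a : (0 < a)%N -> divby E (- 2 * e * logder a L).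
  by move=> a0; apply: se => //; apply: (ON OP).
have se2 a : (0 < a)%N -> divby E (2 * e * logder a L) by move=> a0; apply: se.
have m24 := mulden _ _ _ _ _ _ d2 d4 (Opoch 2%N isT) (Opocht 4%N _ isT OtV) (Opoch 4%N isT)
  (se2 2%N isT) (seN 4%N isT).
have m1 := mulden _ _ _ _ _ _ m24 d1 (O_M OP (Opoch 2%N isT) (Opoch 4%N isT))
  (Opocht 1%N _ isT Ot) (Opoch 1%N isT) (divbyD OP (se2 2%N isT) (seN 4%N isT)) (se2 1%N isT).
have dd := mulden _ _ _ _ _ _ m1 d5
  (O_M OP (O_M OP (Opoch 2%N isT) (Opoch 4%N isT)) (Opoch 1%N isT))
  (Opocht 5%N _ isT OtV) (Opoch 5%N isT)
  (divbyD OP (divbyD OP (se2 2%N isT) (seN 4%N isT)) (se2 1%N isT)) (seN 5%N isT).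
have sE : 2 * e * logder 2 L + - 2 * e * logder 4 L + 2 * e * logder 1 L + - 2 * e * logder 5 L
    = - (e * (2 * logder_sum L)) by rewrite /logder_sum; ring.
rewrite sE expr1 in dd.
set Dt := poch (- (t ^+ 2 * q ^+ 2)) L * _ * _ * _ in dd.
set D1 := poch (- q ^+ 2) L * _ * _ * _ in dd.
have D1U : Ounit D1.
  rewrite /D1 -[in poch (- q)](expr1 q).
  by do 3 (apply: (OunitM OP); last by apply: U1); apply: U1.
have DtU : Ounit Dt.
  rewrite /Dt -[in t ^+ 2 * q](expr1 q).
  by do 3 (apply: (OunitM OP); last by apply: U); apply: U.
set g := e * (2 * logder_sum L) in dd.
have Og : O (2 * logder_sum L).
  apply: (O_M OP) => //; rewrite /logder_sum.
  do 2 (apply: (OD OP); last by apply: OS).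
  by apply: (O_B OP); [apply: (ON OP)|]; apply: OS.
have hg : divby E g by apply: (divbyMl OP).
have gU : Ounit (1 + - g) by apply: Ounit_1D; apply: (divbyN OP).
have ddV : eqm (E + E) Dt^-1 (D1^-1 * (1 + g)).
  apply: (eqm_trans OP (eqmV OP DtU (OunitM OP D1U gU) dd)); rewrite invfM.
  apply: (eqmMl OP); first by case: D1U.
  by rewrite -{2}[g]opprK; apply: eqm_1DV; apply: (divbyN OP).
rewrite /theta_quotient -/Dt !expr1n invr1 !mul1r -/D1.
set P6 := poch (q ^+ 6) L ^+ 2; set B := poch (q ^+ 3) L.
rewrite (_ : t * _ = P6 * (poch (t ^+ 4 * q ^+ 3) L * poch (t ^- 4 * q ^+ 3) L) * (t * Dt^-1));
  last by ring.
rewrite (_ : _ / D1 * _ = P6 * B ^+ 2 * ((1 + (e + g)) / D1)); last by rewrite /g; ring.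
have OP' c : O c -> O (poch c L) by apply: (O_qpoch OP); apply: Oq.
have OP6 : O P6 by apply: (OX OP); apply: OP'; apply: Oq.
apply: (eqmM OP).
- by apply: (O_M OP) => //; apply: (OX OP); apply: OP'; apply: Oq.
- by apply: (O_M OP); [case: tU | case: DtU].
- by apply: (eqmMl OP) => //; apply: theta_numerator.
apply: (eqm_trans OP (b := t * (D1^-1 * (1 + g)))).
  by apply: (eqmMl OP) => //; case: tU.
rewrite mulrCA mulrC; apply: (eqmMr OP); first by case: D1U.
exact: eqm_1DM.
Qed.
End FirstOrder.

(** * From products in base q^6 and Lambert series to eta quotients *)

Lemma qpoch_dissect (R : comPzRingType) (r a : R) c L :
  qpoch r a (c * L) = \prod_(s < c) qpoch (r ^+ c) (a * r ^+ s) L.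
Proof.
rewrite /qpoch exchange_big /=; elim: L => [|L IH]; first by rewrite muln0 !big_ord0.
rewrite mulnS addnC big_split_ord /= IH [RHS]big_ord_recr /=; congr (_ * _).
by apply: eq_bigr => s _; rewrite exprD exprM mulrAC mulrA.
Qed.

Lemma qpoch_signs (R : comPzRingType) (r a : R) n :
  qpoch r a n * qpoch r (- a) n = qpoch (r ^+ 2) (a ^+ 2) n.
Proof.
rewrite /qpoch -big_split; apply: eq_bigr => i _ /=.
by rewrite -exprM mulnC exprM; ring.
Qed.

Lemma big_ord_double (V : nmodType) (f : nat -> V) L :
  \sum_(j < 2 * L) f j = \sum_(i < L) (f (2 * i)%N + f (2 * i + 1)%N).
Proof.
elim: L => [|L IH]; first by rewrite muln0 !big_ord0.
by rewrite mulnS !big_ord_recr /= IH addrA addn1.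
Qed.

Section EtaQuotient.
Variables (F : fieldType) (q : F) (O : F -> Prop).
Hypothesis (OP : local_subring q O).
Local Notation divby := (divby q O).
Local Notation eqm := (eqm q O).
Local Notation Ounit := (Ounit O).
Local Notation Oq := (Oq_exp OP).
Hypothesis two_neq0 : (2 : F) != 0.

Let O1 := O_1 OP.

(** Resummation over k. The values j = 2 i give the residues 1 and 2 modulo 6, the values j = 2 i +
    1 give 4 and 5 with the opposite sign, whence the range 2 L for j. *)
Lemma logder_sum_lambert N L : (N <= L)%N ->
  eqm N (logder_sum q L) (lambert q L (2 * L)).
Proof.
move=> NL; have term a i : (0 < a)%N -> eqm N (q ^+ a * q ^+ 6 ^+ i / (1 + q ^+ a * q ^+ 6 ^+ i))
    (- \sum_(k < L) (-1) ^+ k.+1 * q ^+ (k.+1 * (6 * i + a))).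
  move=> a0; have -> : q ^+ a * q ^+ 6 ^+ i = q ^+ (6 * i + a).
    by rewrite -exprM -exprD addnC.
  set u := q ^+ _.
  have hu : divby 1 (- u).
    by rewrite -mulN1r; apply: (divby_q OP); [rewrite addn_gt0 a0 orbT | apply: (ON OP)].
  have -> : - (\sum_(k < L) (-1) ^+ k.+1 * q ^+ (k.+1 * (6 * i + a)))
      = u * \sum_(k < L) (- u) ^+ k.
    rewrite mulr_sumr -sumrN; apply: eq_bigr => k _.
    rewrite mulnC exprM -/u (exprNn u) !exprS; ring.
  apply: (eqmMl OP); first exact: Oq.
  by rewrite -{1}[u]opprK; apply: (eqm_geometric OP).
rewrite /lambert exchange_big /= (big_ord_double (fun j => \sum_(k < L) (-1) ^+ (k.+1 + j)
  * (q ^+ (k.+1 * (3 * j + 1)) + q ^+ (k.+1 * (3 * j + 2))))).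
rewrite /logder_sum /logder -!sumrN -!big_split /=; apply: (eqm_sum OP) => i _.
set rhs := (X in eqm _ _ X).
pose S a := \sum_(k < L) (-1) ^+ k.+1 * q ^+ (k.+1 * (6 * i + a)).
have -> : rhs = - - S 1%N - - S 2%N + - S 4%N + - S 5%N.
  rewrite /rhs /S !opprK -!sumrN -!big_split; apply: eq_bigr => k _ /=.
  have -> : (3 * (2 * i + 1) + 1 = 6 * i + 4)%N by ring.
  have -> : (3 * (2 * i + 1) + 2 = 6 * i + 5)%N by ring.
  have -> : (3 * (2 * i) = 6 * i)%N by ring.
  have sgn : (-1) ^+ (2 * i) = 1 :> F by rewrite exprM sqrrN !expr1n.
  rewrite (exprD _ k.+1 (2 * i + 1)) (exprD _ k.+1) exprD sgn expr1.
  ring.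
apply: (eqmD OP); last exact: term.
apply: (eqmD OP); last exact: term.
by apply: (eqmB OP); [apply: (eqmN OP) |]; apply: term.
Qed.

Lemma divby_Xq a : (0 < a)%N -> divby 1 (q ^+ a).
Proof. by move=> a0; rewrite -[q ^+ a]mul1r; apply: (divby_q OP). Qed.

Lemma divby_NXq a : (0 < a)%N -> divby 1 (- q ^+ a).
Proof. by move=> a0; apply: (divbyN OP); apply: divby_Xq. Qed.

Lemma Ounit_theta L : Ounit (theta_quotient q 1 L).
Proof.
have U a : divby 1 a -> Ounit (qpoch (q ^+ 6) a L) by apply: (Ounit_qpoch OP); apply: Oq.
have Uq := U _ (divby_Xq _); have UN := U _ (divby_NXq _).
rewrite /theta_quotient !expr1n invr1 !mul1r expr2.
apply: (OunitM OP); first by do 3 (try apply: (OunitM OP)); apply: Uq.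
apply: OunitV; rewrite -[in - q](expr1 q).
by do 3 (apply: (OunitM OP); last by apply: UN); apply: UN.
Qed.

(** Two expansions of [double_sum] at 1 + e are compared modulo q^(2 E). Their constant terms agree
    by the product formula at t = 1, and dividing the rest by e = q^E leaves a congruence modulo
    q^E. *)
Lemma weighted_sum_theta E (N := (E + E)%N) (L := (N + N)%N) : (0 < E)%N ->
  eqm E (weighted_sum q L)
    (theta_quotient q 1 L * (1 + 2 * lambert q L (2 * L))).
Proof.
move=> E0; set e := q ^+ E.
have tU : Ounit (1 + e) by apply: (Ounit_1D OP E0); apply: (divby_unif OP).
have h1 := double_sum_product OP N tU.
have h2 := double_sum_product OP N (Ounit1 OP); rewrite mul1r in h2.
have h3 := double_sum_first_order OP E0 L.
have h4 := theta_quotient_first_order OP E0 L.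
have h5 := logder_sum_lambert (leq_addr N N : N <= L)%N.
have Oth : O (theta_quotient q 1 L) by case: (Ounit_theta L).
have : eqm N (double_sum q 1 L + e * weighted_sum q L)
    (theta_quotient q 1 L * (1 + e * (1 + 2 * logder_sum q L))).
  apply: (eqm_trans OP (eqm_sym OP h3)); apply: (eqm_trans OP h1 h4).
have -> : theta_quotient q 1 L * (1 + e * (1 + 2 * logder_sum q L))
   = theta_quotient q 1 L + e * (theta_quotient q 1 L * (1 + 2 * logder_sum q L)) by ring.
move=> h; have := eqmB OP h h2.
rewrite [X in eqm _ X _]addrAC [X in eqm _ _ X]addrAC !subrr !add0r => {}h.
apply: (eqm_trans OP (b := theta_quotient q 1 L * (1 + 2 * logder_sum q L))).
  move: h; rewrite /eqm /divby -mulrBr /N exprD -/e invfM mulrA.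
  by rewrite [e * _]mulrC mulfK // expf_neq0 // (unif_neq0 OP).
apply: (eqmMl OP) => //; apply: (eqmD OP); first exact: (eqm_refl OP).
apply: (eqmMl OP); first exact: (OD OP).
exact: (eqm_leq OP (leq_addr E E)) h5.
Qed.

Local Notation G m n := (qpoch (q ^+ m) (q ^+ m) n).
Local Notation H m n := (qpoch (q ^+ m) (- q ^+ m) n).

Lemma Xq_dissect m c L :
  G m (c * L) = \prod_(s < c) qpoch (q ^+ (m * c)) (q ^+ (m * s.+1)) L.
Proof. by rewrite qpoch_dissect exprM; apply: eq_bigr => s _; rewrite exprM exprS. Qed.

Lemma NXq_dissect m c L :
  H m (c * L) = \prod_(s < c) qpoch (q ^+ (m * c)) (- q ^+ (m * s.+1)) L.
Proof.
by rewrite qpoch_dissect exprM; apply: eq_bigr => s _; rewrite mulNr exprM exprS.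
Qed.

(** Sorting exponents modulo 6: the numerator holds the classes 3 and 6, each squared, and the
    denominator the classes 1, 2, 4, 5, that is all classes with 3 and 6 removed. As (-q^m; q^m)
    tends to f_(2m) / f_m, the limit is f_1 f_3 f_6 / f_2. *)
Lemma theta_quotient_eta L :
  theta_quotient q 1 L = G 3 (2 * L) ^+ 2 * H 3 (2 * L) / H 1 (6 * L).
Proof.
have UN a : (0 < a)%N -> qpoch (q ^+ 6) (- q ^+ a) L != 0.
  by move=> a0; case: (Ounit_qpoch OP L (Oq 6) (divby_NXq a0)).
rewrite !Xq_dissect !NXq_dissect !big_ord_recr !big_ord0 /= !mul1r.
rewrite !mul1n !muln1 -[(3 * 2)%N]/6%N.
rewrite /theta_quotient !expr1n invr1 !mul1r -[in - q](expr1 q).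
have := UN 1%N isT; have := UN 2%N isT; have := UN 3%N isT; have := UN 4%N isT.
have := UN 5%N isT; have := UN 6%N isT.
move: (qpoch _ (- q ^+ 1) L) (qpoch _ (- q ^+ 2) L) (qpoch _ (- q ^+ 3) L).
move: (qpoch _ (- q ^+ 4) L) (qpoch _ (- q ^+ 5) L) (qpoch _ (- q ^+ 6) L).
move=> a b c d e f h1 h2 h3 h4 h5 h6.
by field; rewrite h1 h2 h3 h4 h5 h6.
Qed.

Lemma eqm_lambert_eta N J (L := (N + N)%N) : (N <= J)%N ->
  eqm N (1 + 2 * lambert q L J)
    (G 3 L * G 1 (3 * L) / (H 1 (3 * L) * H 3 L)).
Proof.
move=> NJ; have := lambert_product OP two_neq0 NJ; rewrite -/L.
have UN a : (0 < a)%N -> qpoch (q ^+ 3) (- q ^+ a) L != 0.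
  by move=> a0; case: (Ounit_qpoch OP L (Oq 3) (divby_NXq a0)).
rewrite !Xq_dissect !NXq_dissect !big_ord_recr !big_ord0 /= !mul1r.
rewrite !mul1n -[in - q](expr1 q) -[in X in _ * qpoch _ X L * qpoch _ (q ^+ 2) L](expr1 q).
have := UN 1%N isT; have := UN 2%N isT; have := UN 3%N isT.
set c := H 3 L; set a := qpoch _ (- q ^+ 1) L; set b := qpoch _ (- q ^+ 2) L.
move=> h1 h2 h3; congr (eqm _ _ _).
by field; rewrite h1 h2 h3.
Qed.

Lemma weighted_sum_eta E n (N := (E + E)%N) (L := (N + N)%N) :
  (0 < E)%N -> (E <= n)%N ->
  eqm E (weighted_sum q L) (G 1 n ^+ 3 * G 3 n ^+ 3 / G 2 n ^+ 2).
Proof.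
move=> E0 En; apply: (eqm_trans OP (weighted_sum_theta E0)).
have UG m k : (0 < m)%N -> Ounit (G m k).
  by move=> m0; apply: (Ounit_qpoch OP) (Oq m) (divby_Xq m0).
have UH m k : (0 < m)%N -> Ounit (H m k).
  by move=> m0; apply: (Ounit_qpoch OP) (Oq m) (divby_NXq m0).
have EL : (E <= L)%N by rewrite /L /N -addnA leq_addr.
have EcL c : (0 < c)%N -> (E <= c * L)%N.
  by move=> c0; apply: leq_trans EL _; rewrite leq_pmull.
have stab m a k : (0 < m)%N -> O a -> (E <= k)%N ->
    eqm E (qpoch (q ^+ m) a k) (qpoch (q ^+ m) a n).
  move=> m0 ha Ek; have [kn|/ltnW nk] := leqP k n.
    exact: (eqm_qpoch OP (divby_Xq m0)).
  by apply: (eqm_sym OP); apply: (eqm_qpoch OP (divby_Xq m0)).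
have stabG m k : (0 < m)%N -> (E <= k)%N -> eqm E (G m k) (G m n).
  by move=> m0; apply: stab => //; apply: Oq.
have stabH m k : (0 < m)%N -> (E <= k)%N -> eqm E (H m k) (H m n).
  by move=> m0; apply: stab => //; apply: (ON OP); apply: Oq.
have OG m k : (0 < m)%N -> O (G m k) by move=> m0; case: (UG m k m0).
have OH m k : (0 < m)%N -> O (H m k) by move=> m0; case: (UH m k m0).
have th : eqm E (theta_quotient q 1 L) (G 3 n ^+ 2 * H 3 n / H 1 n).
  rewrite theta_quotient_eta.
  apply: (eqmM OP).
  - by apply: (O_M OP); [apply: (OX OP); apply: OG | apply: OH].
  - by case: (UH 1%N (6 * L)%N isT).
  - apply: (eqmM OP); [by apply: (OX OP); apply: OG | by apply: OH |
      | by apply: stabH => //; apply: EcL].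
    by rewrite !expr2; apply: (eqmM OP); (try by apply: OG); apply: stabG => //; apply: EcL.
  - by apply: (eqmV OP); (try by apply: UH); apply: stabH => //; apply: EcL.
have la : eqm E (1 + 2 * lambert q L (2 * L)) (G 3 n * G 1 n / (H 1 n * H 3 n)).
  have NJ : (N <= 2 * L)%N by rewrite /L mul2n -addnn -addnA leq_addr.
  apply: (eqm_trans OP (eqm_leq OP (leq_addr E E) (eqm_lambert_eta NJ))).
  apply: (eqmM OP).
  - by apply: (O_M OP); apply: OG.
  - by apply: Ounit_OV; apply: (OunitM OP); apply: UH.
  - by apply: (eqmM OP); (try by apply: OG); apply: stabG => //; apply: EcL.
  - apply: (eqmV OP); try by apply: (OunitM OP); apply: UH.
    by apply: (eqmM OP); (try by apply: OH); apply: stabH => //; apply: EcL.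
apply: (eqm_trans OP (eqmM OP _ _ th la)).
- apply: (O_M OP); first by apply: (O_M OP); [apply: (OX OP); apply: OG | apply: OH].
  by case: (UH 1%N n isT).
- apply: (OD OP) => //; apply: (O_M OP); first exact: (OD OP).
  do 2 (apply: (Osum OP) => ? _); apply: (O_M OP); last by apply: (OD OP); apply: Oq.
  by apply: (OX OP); apply: (ON OP).
have [u1 _ _] := UG 1%N n isT; have [u2 _ _] := UH 1%N n isT.
have [u3 _ _] := UH 3%N n isT.
(* The factors (-q^3; q^3) of the two quotients cancel, and (-q; q)^2 in the denominator becomes
   f_2^2 / f_1^2. *)
rewrite (_ : G 2 n = G 1 n * H 1 n); last by rewrite qpoch_signs -exprM.
rewrite (_ : _ / _ * _ = G 1 n ^+ 3 * G 3 n ^+ 3 / (G 1 n * H 1 n) ^+ 2).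
  exact: (eqm_refl OP).
by field; rewrite u1 u2 u3.
Qed.
End EtaQuotient.

(** * Divisor sums twisted by the character modulo 12 *)

Definition chi12 (a : nat) : int :=
  nth 0 [:: 0; 1; 0; 0; 0; -1; 0; -1; 0; 0; 0; 1] (a %% 12).

Lemma chi12M a b : chi12 (a * b) = chi12 a * chi12 b.
Proof.
rewrite /chi12 -modnMml -modnMmr.
have: (a %% 12 < 12)%N by rewrite ltn_mod.
have: (b %% 12 < 12)%N by rewrite ltn_mod.
move: (a %% 12)%N (b %% 12)%N => i j.
by do 12 (case: j => [|j]; first by do 12 (case: i => [|i] //)).
Qed.

Lemma chi12_sq a : ~~ (2 %| a)%N -> ~~ (3 %| a)%N -> chi12 a * chi12 a = 1.
Proof.
rewrite /chi12 /dvdn -(@modn_dvdm 12 a 2) // -(@modn_dvdm 12 a 3) //.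
have: (a %% 12 < 12)%N by rewrite ltn_mod.
by move: (a %% 12)%N => i; do 12 (case: i => [|i] //).
Qed.

Definition twisted_sigma N : int := \sum_(a <- divisors N) chi12 a * (N %/ a)%:Z.
Definition sigma_twisted N : int := \sum_(a <- divisors N) chi12 a * a%:Z.

Lemma divisors_prime_rec p k m : prime p -> ~~ (p %| m)%N -> (0 < m)%N ->
  perm_eq (divisors (p ^ k.+1 * m)) (divisors m ++ [seq (p * a)%N | a <- divisors (p ^ k * m)]).
Proof.
move=> pp pm m0; have p0 := prime_gt0 pp.
have pm0 j : (0 < p ^ j * m)%N by rewrite muln_gt0 expn_gt0 p0.
apply: uniq_perm; first exact: divisors_uniq.
  rewrite cat_uniq divisors_uniq map_inj_uniq ?divisors_uniq ?andbT /=; last first.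
    by move=> a b /eqP; rewrite eqn_pmul2l // => /eqP.
  apply/hasPn => _ /mapP[a _ ->]; rewrite -dvdn_divisors //.
  by apply: contra pm; apply: dvdn_trans; apply: dvdn_mulr.
move=> a; rewrite mem_cat -!dvdn_divisors //.
have [pa|pa] := boolP (p %| a)%N.
  have [b ->] := dvdnP pa; rewrite [(b * p)%N]mulnC.
  rewrite (mem_map (f := muln p)); last by move=> x y /eqP; rewrite eqn_pmul2l // => /eqP.
  rewrite expnS -mulnA dvdn_pmul2l // -dvdn_divisors //.
  have -> // : (p * b %| m)%N = false.
  by apply/negbTE; apply: contra pm; apply: dvdn_trans; apply: dvdn_mulr.
rewrite Gauss_dvdr; last by rewrite coprime_sym coprimeXl // prime_coprime.
rewrite [X in _ = _ || X](_ : _ = false) ?orbF //.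
apply/negbTE; apply: contra pa => /mapP[b _ ->]; exact: dvdn_mulr.
Qed.

Lemma twisted_sigma_rec p k m : prime p -> ~~ (p %| m)%N -> (0 < m)%N ->
  twisted_sigma (p ^ k.+1 * m)
  = (p ^ k.+1)%:Z * twisted_sigma m + chi12 p * twisted_sigma (p ^ k * m).
Proof.
move=> pp pm m0; have p0 := prime_gt0 pp.
rewrite /twisted_sigma (perm_big _ (divisors_prime_rec k pp pm m0)) big_cat big_map /=.
rewrite !mulr_sumr; congr (_ + _); apply: eq_big_seq => a.
  by rewrite -dvdn_divisors // => am; rewrite -muln_divA // PoszM; ring.
by move=> _; rewrite chi12M expnS -mulnA divnMl // mulrA.
Qed.

Lemma chi12_bound a : `|chi12 a| <= 1.
Proof.
rewrite /chi12; have: (a %% 12 < 12)%N by rewrite ltn_mod.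
by move: (a %% 12)%N => i; do 12 (case: i => [|i] //).
Qed.

(** Write N = p^j m with p prime not dividing m. Since chi12 p is at least - 1, [twisted_sigma_rec]
    gives positivity at p^(k+1) m as soon as the value at p^k m is below p^(k+1) times the value at
    m; so this upper bound is carried along the induction on k. *)
Lemma twisted_sigma_gt0 N : (0 < N)%N -> 0 < twisted_sigma N.
Proof.
elim/ltn_ind: N => N IH N0; have [N1|N1] := leqP N 1.
  have -> : N = 1%N by case: N N0 N1 {IH} => [|[|]].
  by rewrite /twisted_sigma big_seq1.
set p := pdiv N; have pp : prime p by apply: pdiv_prime.
have [m pm NE] := pfactor_coprime pp N0.
have k0 : (0 < logn p N)%N by rewrite logn_gt0 mem_primes pp N0 pdiv_dvd.
have m0 : (0 < m)%N by case: m NE {pm} N0 => [|//] ->; rewrite mul0n.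
have pm' : ~~ (p %| m)%N by rewrite -prime_coprime.
have mN : (m < N)%N.
  by rewrite NE -{1}[m]muln1 ltn_pmul2l // -(expn0 p) ltn_exp2l // prime_gt1.
have hm := IH m mN m0.
rewrite NE mulnC; have : forall k, 0 < twisted_sigma (p ^ k * m)
    /\ twisted_sigma (p ^ k * m) < (p ^ k.+1)%:Z * twisted_sigma m.
  elim=> [|k [h1 h2]].
    rewrite expn0 mul1n expn1; split=> //.
    by rewrite -{1}[twisted_sigma m]mul1r ltr_pM2r // ltz_nat prime_gt1.
  rewrite twisted_sigma_rec //.
  have b : `|chi12 p * twisted_sigma (p ^ k * m)| <= twisted_sigma (p ^ k * m).
    by rewrite normrM (gtr0_norm h1) ler_piMl ?chi12_bound // ltW.
  move: b; rewrite ler_norml => /andP[b1 b2].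
  (* The upper bound survives because the new value is less than 2 p^(k+1) times the value at m, and
     2 <= p. *)
  have up : 2 * ((p ^ k.+1)%:Z * twisted_sigma m) <= (p ^ k.+2)%:Z * twisted_sigma m.
    rewrite mulrA ler_pM2r // (expnS p k.+1) PoszM ler_wpM2r // lez_nat prime_gt1 //.
  by move: up h1 h2 b1 b2; set u := _ * twisted_sigma m; split; lra.
by case/(_ (logn p N)).
Qed.

Lemma divisors_prime_drop (f : nat -> int) p N : prime p -> (0 < N)%N ->
  (forall a, (p %| a)%N -> f a = 0) ->
  \sum_(a <- divisors (p * N)) f a = \sum_(a <- divisors N) f a.
Proof.
move=> pp N0 f0; have pN0 : (0 < p * N)%N by rewrite muln_gt0 prime_gt0.
rewrite (bigID (fun a => p %| a)%N) /= [X in X + _]big1 ?add0r; last by move=> a; apply: f0.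
rewrite [RHS](bigID (fun a => p %| a)%N) /= [X in _ = X + _]big1 ?add0r;
  last by move=> a; apply: f0.
rewrite -big_filter -[RHS]big_filter; apply: perm_big; apply: uniq_perm.
- by rewrite filter_uniq ?divisors_uniq.
- by rewrite filter_uniq ?divisors_uniq.
move=> a; rewrite !mem_filter -!dvdn_divisors //.
have [//|pa] := boolP (p %| a)%N.
by rewrite Gauss_dvdr // coprime_sym prime_coprime.
Qed.

Lemma chi12_eq0 a : (2 %| a)%N || (3 %| a)%N -> chi12 a = 0.
Proof.
rewrite /chi12 /dvdn -(@modn_dvdm 12 a 2) // -(@modn_dvdm 12 a 3) //.
have: (a %% 12 < 12)%N by rewrite ltn_mod.
by move: (a %% 12)%N => i; do 12 (case: i => [|i] //).
Qed.

Lemma perm_divisors_rev N : (0 < N)%N ->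
  perm_eq (divisors N) [seq (N %/ a)%N | a <- divisors N].
Proof.
move=> N0; apply: uniq_perm; first exact: divisors_uniq.
  rewrite map_inj_in_uniq ?divisors_uniq // => a b; rewrite -!dvdn_divisors // => aN bN E.
  have a0 : (0 < N %/ a)%N by rewrite divn_gt0 ?(dvdn_leq N0) ?(dvdn_gt0 N0).
  by apply/eqP; rewrite -(eqn_pmul2l a0) divnK // E divnK.
move=> a; rewrite -dvdn_divisors //; apply/idP/mapP => [aN|[b]].
  exists (N %/ a)%N; first by rewrite -dvdn_divisors // dvdn_div.
  by rewrite divnA // mulKn.
by rewrite -dvdn_divisors // => bN ->; apply: dvdn_div.
Qed.

(** For N prime to 6, the substitution a -> N / a and chi12 (N / a) = chi12 N * chi12 a show that
    the two sums agree up to the sign chi12 N. A prime factor 2 or 3 of N can be removed: this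
    leaves [sigma_twisted] unchanged, since chi12 vanishes on its multiples, and divides
    [twisted_sigma] by that prime. *)
Lemma sigma_twisted_bound N : (0 < N)%N -> `|sigma_twisted N| <= twisted_sigma N.
Proof.
elim/ltn_ind: N => N IH N0.
have step p : prime p -> (p %| 6)%N -> (p %| N)%N -> `|sigma_twisted N| <= twisted_sigma N.
  move=> pp p6 /dvdnP[m Nm]; have m0 : (0 < m)%N by move: N0; rewrite Nm; case: (m).
  have chi0 a : (p %| a)%N -> chi12 a = 0.
    move=> pa; apply: chi12_eq0; apply/orP.
    by move: p6; rewrite (Euclid_dvdM 2 3) // => /orP[]; rewrite dvdn_prime2 // => /eqP <-;
      [left|right].
  have mN : (m < N)%N by rewrite Nm -{1}[m]muln1 ltn_pmul2l // prime_gt1.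
  apply: le_trans (_ : twisted_sigma m <= _).
    rewrite Nm mulnC /sigma_twisted divisors_prime_drop //; last first.
      by move=> a pa; rewrite chi0 ?mul0r.
    exact: IH.
  rewrite Nm mulnC [leRHS]/twisted_sigma divisors_prime_drop //; last first.
    by move=> a pa; rewrite chi0 ?mul0r.
  rewrite (_ : \sum_(a <- _) _ = p%:Z * twisted_sigma m); last first.
    rewrite mulr_sumr; apply: eq_big_seq => a; rewrite -dvdn_divisors // => am.
    by rewrite -muln_divA // PoszM mulrCA.
  by rewrite ler_peMl ?lez_nat ?prime_gt0 // ltW // twisted_sigma_gt0.
have [N2|N2] := boolP (2 %| N)%N; first exact: (step 2).
have [N3|N3] := boolP (3 %| N)%N; first exact: (step 3).
have -> : sigma_twisted N = chi12 N * twisted_sigma N.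
  rewrite /sigma_twisted (perm_big _ (perm_divisors_rev N0)) big_map mulr_sumr.
  apply: eq_big_seq => a; rewrite -dvdn_divisors // => aN.
  have -> : chi12 N = chi12 (N %/ a) * chi12 a by rewrite -chi12M divnK.
  rewrite mulrA -[_ * chi12 a * chi12 a]mulrA chi12_sq ?mulr1 //.
  - by apply: contra N2 => /dvdn_trans; apply.
  - by apply: contra N3 => /dvdn_trans; apply.
rewrite normrM (gtr0_norm (twisted_sigma_gt0 N0)) ler_piMl ?chi12_bound // ltW //.
exact: twisted_sigma_gt0.
Qed.

(** * Coefficients of the weighted double series as divisor sums *)

Lemma chi12_1mod6 k : chi12 (6 * k + 1) = (-1) ^+ k.
Proof.
rewrite -signr_odd /chi12 -{1}(odd_double_half k) mulnDr -mul2n mulnA.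
have -> : (6 * odd k + 6 * 2 * k./2 + 1 = k./2 * 12 + (6 * odd k + 1))%N by ring.
by rewrite modnMDl; case: (odd k).
Qed.

Lemma chi12_5mod6 k : chi12 (6 * k + 5) = - (-1) ^+ k.
Proof.
rewrite -signr_odd /chi12 -{1}(odd_double_half k) mulnDr -mul2n mulnA.
have -> : (6 * odd k + 6 * 2 * k./2 + 5 = k./2 * 12 + (6 * odd k + 5))%N by ring.
by rewrite modnMDl; case: (odd k).
Qed.

Lemma sum_divisors (f : nat -> int) N B : (0 < N)%N -> (N < B)%N ->
  \sum_(a <- divisors N) f a = \sum_(a < B) (if (a %| N)%N then f a else 0).
Proof.
move=> N0 NB; rewrite -(big_mkord xpredT (fun a => if (a %| N)%N then f a else 0)) -big_mkcond /=.
rewrite -[RHS]big_filter; apply: perm_big; apply: uniq_perm.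
- exact: divisors_uniq.
- by rewrite filter_uniq ?iota_uniq.
move=> a; rewrite mem_filter -dvdn_divisors // mem_index_iota.
have [aN|//] := boolP (a %| N)%N.
by rewrite (leq_ltn_trans (dvdn_leq N0 aN) NB).
Qed.

Lemma big_ord_six (V : nmodType) (f : nat -> V) L :
  \sum_(a < 6 * L) f a = \sum_(k < L) (f (6 * k)%N + f (6 * k + 1)%N + f (6 * k + 2)%N
     + f (6 * k + 3)%N + f (6 * k + 4)%N + f (6 * k + 5)%N).
Proof.
elim: L => [|L IH]; first by rewrite muln0 !big_ord0.
by rewrite mulnS !big_ord_recr /= IH !addnS addn0 !addrA.
Qed.

Lemma big_ord_single (L n : nat) (F : nat -> int) (e : nat -> nat) m0 :
  (m0 < L)%N -> n = e m0 -> (forall m, n = e m -> m = m0) ->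
  \sum_(m < L) F m * (n == e m)%:R = F m0.
Proof.
move=> h1 h2 h3; rewrite (bigD1 (Ordinal h1)) //= -h2 eqxx mulr1 big1 ?addr0 // => i.
have [/h3 E|_] := eqVneq n (e i); last by rewrite mulr0.
by case/negP; apply/eqP/val_inj.
Qed.

Lemma big_ord_none (L n : nat) (F : nat -> int) (e : nat -> nat) :
  (forall m, n <> e m) -> \sum_(m < L) F m * (n == e m)%:R = 0.
Proof.
by move=> h; rewrite big1 // => m _; case: eqP => [/h|]; rewrite ?mulr0.
Qed.

Definition weighted_coef L n : int :=
  \sum_(k < L) \sum_(m < L) (-1) ^+ (k + m) * (2 * (k + m) + 1)%:R
     * (n == 6 * k * m + 2 * k + m)%N%:R
  + \sum_(m < L) \sum_(k < L) (-1) ^+ (k + m) * (2 * (k + m) + 3)%:R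
     * (n == 6 * k * m + 4 * m + 5 * k + 3)%N%:R.

(* 3 n + 1 = (6 k + 1) (3 m + 1) in the first sum of [weighted_coef] and
   3 n + 1 = (6 m + 5) (3 k + 2) in the second. *)
Lemma weighted_coef_divisors L n : (n < L)%N ->
  3 * ((-1) ^+ n * weighted_coef L n)
  = sigma_twisted (3 * n + 1) + 2 * twisted_sigma (3 * n + 1).
Proof.
move=> nL; set N := (3 * n + 1)%N; have N0 : (0 < N)%N by rewrite /N addn1.
pose f a : int := chi12 a * (a%:Z + 2 * (N %/ a)%:Z).
have -> : sigma_twisted N + 2 * twisted_sigma N = \sum_(a <- divisors N) f a.
  by rewrite /sigma_twisted /twisted_sigma mulr_sumr -big_split; apply: eq_bigr => a _;
    rewrite /f /=; ring.
rewrite (@sum_divisors _ N (6 * L)) //; last by rewrite /N; lia.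
rewrite (big_ord_six (fun a => if (a %| N)%N then f a else 0)).
have f0 a : (2 %| a)%N || (3 %| a)%N -> (if (a %| N)%N then f a else 0) = 0.
  by move=> h; rewrite /f chi12_eq0 // mul0r; case: ifP.
rewrite (eq_bigr (fun k : 'I_L => (if (6 * k + 1 %| N)%N then f (6 * k + 1)%N else 0)
   + (if (6 * k + 5 %| N)%N then f (6 * k + 5)%N else 0))); last first.
  move=> k _; rewrite (f0 (6 * k)%N); last by lia.
  rewrite (f0 (6 * k + 2)%N); last by lia.
  rewrite (f0 (6 * k + 3)%N); last by lia.
  rewrite (f0 (6 * k + 4)%N); last by lia.
  by rewrite add0r !addr0.
(* The divisor a fixes the outer index in each half; the cofactor b then leaves at most one inner
   index. *)
rewrite big_split /weighted_coef !mulrDr /=; congr (_ + _).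
  rewrite !mulr_sumr; apply: eq_bigr => k _.
  pose F m : int := (-1) ^+ (k + m) * (2 * (k + m) + 1)%:R.
  pose e m := (6 * k * m + 2 * k + m)%N.
  have [/dvdnP[b Nb]|nd] := boolP (6 * k + 1 %| N)%N; last first.
    rewrite (@big_ord_none L n F e) ?mulr0 // => m nE; case/negP: nd.
    by apply/dvdnP; exists (3 * m + 1)%N; rewrite /N nE /e; ring.
  (* Both 3 n + 1 and 6 k + 1 are 1 modulo 3, hence so is the cofactor. *)
  have [m bE] : exists m, b = (3 * m + 1)%N.
    exists (b %/ 3)%N; move: Nb; rewrite /N {1 2}(divn_eq b 3).
    have : (b %% 3 < 3)%N by rewrite ltn_mod.
    by move: (b %/ 3)%N (b %% 3)%N => m [|[|[|//]]] _; nia.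
  have nE : n = e m by move: Nb; rewrite /N /e bE; nia.
  rewrite (@big_ord_single L n F e m) //.
  - rewrite /f Nb mulnK; last by rewrite addn1.
    rewrite chi12_1mod6 /F exprD bE.
    (* Here n and m have the same parity, so the sign left over is (-1)^k = chi12 (6 k + 1). *)
    have -> : (-1) ^+ n = (-1) ^+ m :> int.
      rewrite -signr_odd -[RHS]signr_odd nE /e !oddD !oddM.
      by case: (odd k); case: (odd m).
    have <- : 3 * (2 * (k + m) + 1)%:R = (6 * k + 1)%:Z + 2 * (3 * m + 1)%:Z.
      by rewrite natz; lia.
    rewrite (_ : 3 * _ = ((-1) ^+ m) ^+ 2 * (-1) ^+ k * (3 * (2 * (k + m) + 1)%:R)).
      by rewrite sqrr_sign mul1r.
    by ring.
  - by apply: leq_ltn_trans nL; rewrite nE /e leq_addl.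
  - move=> m' nE'; have : ((6 * k + 1) * m' == (6 * k + 1) * m)%N.
      by apply/eqP; move: nE nE'; rewrite /e; lia.
    by rewrite eqn_pmul2l ?addn1 // => /eqP.
rewrite !mulr_sumr; apply: eq_bigr => m _.
pose F k : int := (-1) ^+ (k + m) * (2 * (k + m) + 3)%:R.
pose e k := (6 * k * m + 4 * m + 5 * k + 3)%N.
have [/dvdnP[b Nb]|nd] := boolP (6 * m + 5 %| N)%N; last first.
  rewrite (@big_ord_none L n F e) ?mulr0 // => k nE; case/negP: nd.
  by apply/dvdnP; exists (3 * k + 2)%N; rewrite /N nE /e; ring.
have [k bE] : exists k, b = (3 * k + 2)%N.
  exists (b %/ 3)%N; move: Nb; rewrite /N {1 2}(divn_eq b 3).
  have : (b %% 3 < 3)%N by rewrite ltn_mod.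
  by move: (b %/ 3)%N (b %% 3)%N => k [|[|[|//]]] _; nia.
have nE : n = e k by move: Nb; rewrite /N /e bE; nia.
rewrite (@big_ord_single L n F e k) //.
- rewrite /f Nb mulnK; last by rewrite addnS.
  rewrite chi12_5mod6 /F exprD bE.
  (* Here n and k have opposite parities, so the sign left over is - (-1)^m = chi12 (6 m + 5). *)
  have -> : (-1) ^+ n = - (-1) ^+ k :> int.
    rewrite -signr_odd -[in RHS]signr_odd nE /e !oddD !oddM.
    by case: (odd k); case: (odd m).
  have <- : 3 * (2 * (k + m) + 3)%:R = (6 * m + 5)%:Z + 2 * (3 * k + 2)%:Z.
    by rewrite natz; lia.
  rewrite (_ : 3 * _ = - ((-1) ^+ k) ^+ 2 * (-1) ^+ m * (3 * (2 * (k + m) + 3)%:R)).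
    by rewrite sqrr_sign mulN1r.
  by ring.
- by apply: leq_ltn_trans nL; rewrite nE /e; nia.
- move=> k' nE'; have : ((6 * m + 5) * k' == (6 * m + 5) * k)%N.
    by apply/eqP; move: nE nE'; rewrite /e; lia.
  by rewrite eqn_pmul2l ?addnS // => /eqP.
Qed.

(** * Back to coefficients of integer polynomials *)

Local Notation "x %:F" := (@FracField.tofrac _ x).

(** Denominators with constant term 1 are invertible as integer power series and are closed under
    products and under adding a multiple of q. *)
Definition power_series_fraction (x : {fraction {poly int}}) : Prop :=
  exists n d : {poly int}, d`_0 = 1 /\ x * d%:F = n%:F.

Local Notation O := power_series_fraction.
Local Notation "''q'" := ('X%:F : {fraction {poly int}}).

Lemma tofrac_coef0_neq0 (d : {poly int}) : d`_0 = 1 -> d%:F != 0.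
Proof. by move=> d0; rewrite tofrac_eq0; apply: contra_eq_neq d0 => ->; rewrite coef0. Qed.

Lemma power_series_fraction_poly (a : {poly int}) : O a%:F.
Proof. by exists a, 1; rewrite coef1 tofrac1 mulr1. Qed.

Lemma local_subring_power_series : local_subring 'q O.
Proof.
split.
- by rewrite tofrac_eq0 polyX_eq0.
- exact: power_series_fraction_poly.
- by rewrite -tofrac1; apply: power_series_fraction_poly.
- move=> a b [n [d [d0 E]]] [n' [d' [d0' E']]].
  exists (n * d' - n' * d), (d * d'); split; first by rewrite coef0M d0 d0' mulr1.
  rewrite tofracB !tofracM -E -E'; ring.
- move=> a b [n [d [d0 E]]] [n' [d' [d0' E']]].
  exists (n * n'), (d * d'); split; first by rewrite coef0M d0 d0' mulr1.
  by rewrite !tofracM -E -E'; ring.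
- move=> a [n [d [d0 E]]].
  have e0 : (d + 'X * n)`_0 = 1 by rewrite coefD d0 coefXM addr0.
  have eE : (1 + 'q * a) * d%:F = (d + 'X * n)%:F.
    by rewrite tofracD tofracM -E; ring.
  have u0 : 1 + 'q * a != 0.
    apply: contraNneq (tofrac_coef0_neq0 e0) => u0.
    by rewrite -eE u0 mul0r.
  split=> //; exists d, (d + 'X * n); split=> //.
  by rewrite -eE mulKf.
Qed.

Lemma coef_mul_unit0 (c d : {poly int}) E : d`_0 = 1 ->
  (forall i, (i < E)%N -> (c * d)`_i = 0) -> forall i, (i < E)%N -> c`_i = 0.
Proof.
move=> d0 h; elim/ltn_ind=> i IH iE; have := h i iE.
rewrite coefM big_ord_recr /= subnn d0 mulr1 big1 ?add0r // => j _.
by rewrite IH ?mul0r // (ltn_trans _ iE).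
Qed.

(** Clearing denominators gives (a - b) d = n q^E with d of constant term 1, and such a d can be
    divided out below degree E. *)
Lemma eqm_coef E (a b : {poly int}) i : (i < E)%N -> eqm 'q O E a%:F b%:F -> a`_i = b`_i.
Proof.
move=> iE [n [d [d0 h]]]; apply/eqP; rewrite -subr_eq0 -coefB; apply/eqP.
apply: (coef_mul_unit0 d0 _ iE) => j jE.
have qE : 'q ^+ E != 0 by rewrite expf_neq0 // tofrac_eq0 polyX_eq0.
have : ((a - b) * d)%:F = (n * 'X^E)%:F.
  by rewrite !tofracM tofracB tofracXn -h mulrAC divfK.
by move/eqP; rewrite tofrac_eq => /eqP ->; rewrite coefMXn jE.
Qed.

Lemma tofrac_qpoch_trunc m n : (qpoch_trunc m n)%:F = qpoch ('q ^+ m) ('q ^+ m) n.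
Proof.
rewrite /qpoch_trunc big_add1 /= big_mkord rmorph_prod; apply: eq_bigr => i _.
by rewrite /= tofracB tofrac1 tofracXn -exprS -exprM.
Qed.

Lemma eqm_qpoch_inv_trunc m n : (0 < m)%N ->
  eqm 'q O n.+1 (qpoch_inv_trunc m n)%:F (qpoch ('q ^+ m) ('q ^+ m) n)^-1.
Proof.
have OP := local_subring_power_series.
move=> m0; rewrite /qpoch_inv_trunc big_add1 /= big_mkord rmorph_prod /qpoch -prodfV.
have hv i : divby 'q O 1 ('q ^+ m * 'q ^+ m ^+ i).
  by rewrite -exprS -exprM -['q ^+ _]mul1r; apply: (divby_q OP) (O_1 OP); rewrite muln_gt0 m0.
have geo i : eqm 'q O n.+1 (\sum_(0 <= k < n.+1) 'X^(m * i.+1 * k))%:F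
    (1 - 'q ^+ m * 'q ^+ m ^+ i)^-1.
  rewrite big_mkord rmorph_sum.
  rewrite (eq_bigr (fun k : 'I_n.+1 => ('q ^+ m * 'q ^+ m ^+ i) ^+ k)); last first.
    by move=> k _; rewrite /= tofracXn exprM (exprM _ m) exprS.
  by apply: (eqm_sym OP); apply: (eqm_geometric OP).
apply: (eqm_prod OP) => i _ //=; first exact: power_series_fraction_poly.
by case: (Ounit_1B OP (hv i)).
Qed.

Definition weighted_poly L : {poly int} :=
  \sum_(k < L) \sum_(m < L) ((-1) ^+ (k + m) * (2 * (k + m) + 1)%:R)%:P
     * 'X^(6 * k * m + 2 * k + m)
  + \sum_(m < L) \sum_(k < L) ((-1) ^+ (k + m) * (2 * (k + m) + 3)%:R)%:P
     * 'X^(6 * k * m + 4 * m + 5 * k + 3).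

Lemma tofrac_weighted_poly L : (weighted_poly L)%:F = weighted_sum 'q L.
Proof.
have tofrac_monomial j c e :
    (((-1) ^+ j * c%:R)%:P * 'X^e : {poly int})%:F = (-1) ^+ j * c%:R * 'q ^+ e.
  by rewrite tofracM tofracXn polyCM rmorphXn rmorphN1 rmorph_nat tofracM rmorph_nat
    tofracXn rmorphN1.
rewrite /weighted_poly /weighted_sum tofracD !rmorph_sum.
by congr (_ + _); apply: eq_bigr => i _; rewrite rmorph_sum; apply: eq_bigr => j _ /=;
  rewrite tofrac_monomial.
Qed.

Lemma coef_weighted_poly L n : (weighted_poly L)`_n = weighted_coef L n.
Proof.
rewrite /weighted_poly /weighted_coef coefD !coef_sum.
by congr (_ + _); apply: eq_bigr => i _; rewrite coef_sum; apply: eq_bigr => j _;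
  rewrite coefCM coefXn.
Qed.

(** Precision E = n + 1 is what the coefficient of q^n requires; [weighted_sum_theta] doubles it
    once for the infinitesimal and once for the truncation of Kronecker's sum, whence the range 4 (n
    + 1). *)
Lemma C_eta_weighted_coef n (N := (n.+1 + n.+1)%N) :
  C_eta n = weighted_coef (N + N) n.
Proof.
have OP := local_subring_power_series.
have two0 : 2 != 0 :> {fraction {poly int}}.
  by rewrite -(rmorph_nat (@FracField.tofrac _)) tofrac_eq0 -polyC_natr polyC_eq0.
rewrite -coef_weighted_poly; apply: (eqm_coef (ltnSn n)).
rewrite tofrac_weighted_poly; apply: (eqm_sym OP).
apply: (eqm_trans OP (weighted_sum_eta OP two0 (ltn0Sn n) (leqnn n.+1))).
rewrite 2!tofracM !tofracXn !tofrac_qpoch_trunc.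
have Oq := Oq_exp OP.
have dq m : (0 < m)%N -> divby 'q O 1 ('q ^+ m) by exact: divby_Xq.
have U m k : (0 < m)%N -> Ounit O (qpoch ('q ^+ m) ('q ^+ m) k).
  by move=> m0; apply: (Ounit_qpoch OP _ (Oq m) (dq m m0)).
have OG m k : (0 < m)%N -> O (qpoch ('q ^+ m) ('q ^+ m) k).
  by move=> m0; case: (U m k m0).
have OI := power_series_fraction_poly (qpoch_inv_trunc 2 n).
(* [weighted_sum_eta] needs n + 1 factors at this precision while [C_eta] uses n; the extra factor
   is 1 - q^(m (n + 1)). *)
have step m : (0 < m)%N ->
    eqm 'q O n.+1 (qpoch ('q ^+ m) ('q ^+ m) n.+1) (qpoch ('q ^+ m) ('q ^+ m) n).
  move=> m0; rewrite qpochS -[X in eqm _ _ _ _ X]mulr1; apply: (eqmMl OP (OG m n m0)).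
  rewrite /eqm addrC addKr; apply: (divbyN OP); rewrite -exprS -exprM -['q ^+ _]mul1r.
  by apply: (divby_q OP) (O_1 OP); rewrite leq_pmull.
have cube a b : O a -> O b -> eqm 'q O n.+1 a b -> eqm 'q O n.+1 (a ^+ 3) (b ^+ 3).
  move=> Oa Ob h; rewrite !exprS !expr0 !mulr1.
  by apply: (eqmM OP) => //; [apply: (O_M OP) | apply: (eqmM OP)].
apply: (eqmM OP).
- by apply: (O_M OP); apply: (OX OP); apply: OG.
- by apply: Ounit_OV; rewrite expr2; apply: (OunitM OP); apply: U.
- apply: (eqmM OP).
  + by apply: (OX OP); apply: OG.
  + by apply: (OX OP); apply: OG.
  + by apply: cube; [apply: OG | apply: OG | apply: step].
  + by apply: cube; [apply: OG | apply: OG | apply: step].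
rewrite -exprVn !expr2; have V : eqm 'q O n.+1 (qpoch ('q ^+ 2) ('q ^+ 2) n.+1)^-1
    (qpoch_inv_trunc 2 n)%:F.
  apply: (eqm_trans OP (eqmV OP (U 2%N n.+1 isT) (U 2%N n isT) (step 2%N isT))).
  by apply: (eqm_sym OP); apply: eqm_qpoch_inv_trunc.
by apply: (eqmM OP) => //; case: (U 2%N n.+1 isT).
Qed.

Lemma C_eta_sign n : 0 < (-1) ^+ n * C_eta n.
Proof.
have nL : (n < n.+1 + n.+1 + (n.+1 + n.+1))%N by rewrite -addnA leq_addr.
have N0 : (0 < 3 * n + 1)%N by rewrite addn1.
have := sigma_twisted_bound N0; have := twisted_sigma_gt0 N0.
have := weighted_coef_divisors nL; rewrite -C_eta_weighted_coef ler_norml.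
by move=> E h1 /andP[h2 _]; lra.
Qed.

Theorem theorem1p2 :
  (forall n : nat, (1 <= n)%N -> sgz (C_eta (n + 2)) = sgz (C_eta n)) /\
  (forall n : nat, (1 <= n)%N -> 0 < (-1) ^+ n * C_eta n).
Proof.
split=> n _; last exact: C_eta_sign.
have sgzE m : sgz (C_eta m) = (-1) ^+ m.
  have := C_eta_sign m; rewrite -signr_odd; case: (odd m).
    by rewrite expr1 mulN1r oppr_gt0 => /ltr0_sgz.
  by rewrite expr0 mul1r => /gtr0_sgz.
by rewrite !sgzE exprD sqrrN expr1n mulr1.
Qed.
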